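(* For every integer $k \ge 3$ and every $\alpha > 0$, there exist $C>0$ and $n_0$ such that the following holds for every $n \ge n_0$. Let $G$ be a graph with $n$ vertices and minimum degree at least $\left(\frac{1}{k+1} + \alpha\right)n$. Then for every $p\in[0,1]$ with $p \ge C n^{-1/(k-1)}$, the graph $G \cup G(n,p)$ contains the $k$-th power of a Hamilton cycle with probability at least $1/2$.
   Context: Graphs are finite and simple. $G(n,p)$ denotes the binomial random graph, here on the vertex set $V(G)$: each of the $\binom n2$ pairs of vertices is an edge independently with probability $p$. $G\cup G(n,p)$ is the graph on $V(G)$ whose edge set is the union of the two edge sets. A graph on $n$ vertices contains the $k$-th power of a Hamilton cycle if its vertices can be cyclically ordered so that any two distinct vertices at cyclic distance at most $k$ in this ordering are adjacent. *)

(* Defs.v *)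
From HB Require Import structures.
From mathcomp Require Import all_boot all_order all_algebra.
From mathcomp Require Import reals.

Set Implicit Arguments.
Unset Strict Implicit.
Unset Printing Implicit Defensive.

Import Order.TTheory GRing.Theory Num.Theory.

Local Open Scope nat_scope.

Definition pairs (V : finType) : {set {set V}} := [set e : {set V} | #|e| == 2].

Record sgraph (V : finType) := SGraph {
  edges :> {set {set V}};
  edges_pairs : edges \subset pairs V }.

HB.instance Definition _ (V : finType) := [isSub for @edges V].
HB.instance Definition _ (V : finType) := [Finite of sgraph V by <:].

Definition adj (V : finType) (G : sgraph V) : rel V :=
  fun x y => [set x; y] \in edges G.

Definition degree (V : finType) (G : sgraph V) (x : V) : nat :=
  #|[set y | adj G x y]|.

(* Degrees are smaller than #|V|, so the default value #|V| only matters when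
   V is empty. *)
Definition min_degree (V : finType) (G : sgraph V) : nat :=
  \big[minn/#|V|]_(x : V) degree G x.

Lemma union_subproof (V : finType) (G H : sgraph V) :
  edges G :|: edges H \subset pairs V.
Proof. by rewrite subUset !edges_pairs. Qed.

Definition graph_union (V : finType) (G H : sgraph V) : sgraph V :=
  SGraph (union_subproof G H).

Definition cyclic_dist (n : nat) (i j : 'I_n) : nat :=
  minn ((i + (n - j)) %% n) ((j + (n - i)) %% n).

(* A cyclic ordering of V is given by an injection from 'I_#|V| to V, which is
   automatically a bijection. *)
Definition has_ham_cycle_power (k : nat) (V : finType) (G : sgraph V) : bool :=
  [exists c : {ffun 'I_#|V| -> V}, injectiveb c &&
    [forall i, forall j,
      (i != j) && (cyclic_dist i j <= k) ==> adj G (c i) (c j)]].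

Local Open Scope ring_scope.

(* Point mass of the binomial random graph on V: the product over all pairs of
   independent Bernoulli(p) weights. *)
Definition gnp_mass (R : realType) (V : finType) (p : R) (H : sgraph V) : R :=
  \prod_(e in pairs V) (if e \in edges H then p else 1 - p).

Definition gnp_prob (R : realType) (V : finType) (p : R)
    (A : pred (sgraph V)) : R :=
  \sum_(H : sgraph V | A H) gnp_mass p H.

Lemma adj_irr (V : finType) (G : sgraph V) : irreflexive (adj G).
Proof.
move=> x; apply/negP => /(subsetP (edges_pairs G)).
by rewrite inE setUid cards1.
Qed.

Lemma adj_sym (V : finType) (G : sgraph V) : symmetric (adj G).
Proof. by move=> x y; rewrite /adj setUC. Qed.

Lemma leq_min_degree (V : finType) (G : sgraph V) (d : nat) :
  (d <= #|V|)%N ->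
  (d <= min_degree G)%N <-> forall x, (d <= degree G x)%N.
Proof.
move=> dV; rewrite /min_degree; split=> [dG x|dG].
  apply: leq_trans dG _; have := mem_index_enum x.
  elim: (index_enum V) => // y s IHs; rewrite inE big_cons geq_min.
  by case/orP => [/eqP <-|/IHs ->]; rewrite ?leqnn ?orbT.
by elim/big_ind: _ => // a b da db; rewrite leq_min da db.
Qed.

Lemma gnp_prob_total (R : realType) (V : finType) (p : R) :
  gnp_prob p (@predT (sgraph V)) = 1.
Proof.
pose F (e : {set V}) : R := if e \in pairs V then p else 0.
pose G (e : {set V}) : R := if e \in pairs V then 1 - p else 1.
have FG1 : \prod_e (F e + G e) = 1.
  by apply: big1 => e _; rewrite /F /G; case: ifP => _;
    rewrite ?add0r // addrC subrK.
pose h (E : {set {set V}}) : sgraph V :=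
  insubd (SGraph (sub0set (pairs V))) E.
have hE E : (edges (h E) == E) = (E \subset pairs V).
  by apply/eqP/idP => [<-|EP]; [exact: edges_pairs | exact: (insubdK _ EP)].
rewrite -FG1 bigA_distr (bigID (fun E : {set {set V}} => E \subset pairs V)) /=.
rewrite [X in _ = _ + X]big1 ?addr0 => [|E /subsetPn [e eE eP]]; last first.
  by rewrite (bigD1 e) //= eE /F (negbTE eP) mul0r.
rewrite /gnp_prob (reindex_onto h (@edges V)) /=; last first.
  by move=> H _; exact: (valKd _ H).
rewrite (eq_bigl _ _ hE); apply: eq_bigr => E EP.
have -> : gnp_mass p (h E) = \prod_(e in pairs V) (if e \in E then p else 1 - p).
  by move: EP; rewrite -hE => /eqP {2}<-.
rewrite big_mkcond; apply: eq_bigr => e _; rewrite /F /G.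
by case: ifP => // eP; case: ifP => // /(subsetP EP); rewrite eP.
Qed.

(* Main.v *)
From HB Require Import structures.
From mathcomp Require Import all_boot all_order all_algebra.
From mathcomp Require Import lra ring zify.
From mathcomp Require Import reals sequences exp.
Require Import Defs.

(** Call a pair of vertices missing when it is not an edge of G, and put
    d = k - 1.  The idea is to produce a random cyclic order of the vertices for
    which the set S of the missing pairs at cyclic distance at most k is spread:
    for every set T of pairs, the probability that T lies in S is at most
    q ^ #|T|, where q is smaller than n ^ (- 1 / d) by a power of n.  The random
    graph then contains one of the possible sets S with probability at least
    1/2.  This is the fractional expectation-threshold theorem
    [spread_threshold], obtained by the minimal-fragment argument of Park and
    Pham; the logarithm that it costs is absorbed by the spare power of n.

    For the random order, label the vertices independently and uniformly with N
    labels, N being n divided by a small power of n.  With probability at least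
    1/2 every vertex has the expected proportion of neighbours in every label
    class, up to a small error [most_labellings_balanced].  For such a labelling
    the order is chosen deterministically.  Fix constants a and b with a / (a + b)
    slightly larger than 1 / (k + 1).  Since the degrees inside a class exceed
    the proportion a / (a + b), disjoint copies of the complete bipartite graph
    with sides a and b cover the class up to fewer vertices than there are
    copies [almost_tiling]; the proof starts from much larger bipartite graphs
    and rebuilds them with uncovered vertices.  Each copy, together with at most
    one uncovered vertex x, is spelled as a word
        (A B^k)^q  A^k B x A B A B
    whose letters A and B are vertices of the two sides, and the words are
    concatenated, the classes in cyclic order.

    Two properties of the words make S sparse.  Every missing pair at distance
    at most k avoids the cut between the last B^k of the first part and A^k, so
    that S splits into segments of bounded length L.  Moreover each vertex has a
    neighbour among its k predecessors, except the first letter A and x; these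
    two follow a vertex that has two such neighbours, and swapping them with it
    gives an order in which every vertex is in at most d missing pairs with
    earlier vertices [elimination].  Hence a set T of missing pairs contains a
    forest with at least #|T| * L / (L * d - 1) edges [forest_exists]; the small
    gain over #|T| / d comes from the first vertices of each segment.  Finally
    the two ends of a pair of S have equal or consecutive labels, so that every
    edge of the forest costs a factor 3 / N [count_close].  The resulting q is
    about N ^ (- L / (L * d - 1)), which beats n ^ (- 1 / d). *)

Set Implicit Arguments.
Unset Strict Implicit.
Unset Printing Implicit Defensive.

Import Order.TTheory GRing.Theory Num.Theory.

(** * Spread families and random sets *)

Section Spread.
Local Open Scope ring_scope.
Variables (R : realFieldType) (E : finType).
Implicit Types (W S T Z : {set E}) (H U : {set {set E}}).

Definition wt (p : R) W : R := \prod_(e : E) (if e \in W then p else 1 - p).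

Lemma wt_ge0 p W : 0 <= p -> p <= 1 -> 0 <= wt p W.
Proof. by move=> p0 p1; apply: prodr_ge0 => e _; case: ifP => _ //; rewrite subr_ge0. Qed.

Lemma sum_wt p : \sum_W wt p W = 1.
Proof.
by rewrite /wt -bigA_distr big1 // => e _; rewrite /=; lra.
Qed.

Lemma sum_wt_union p2 W1 W :
  \sum_(W2 | W1 :|: W2 == W) wt p2 W2 =
  \prod_e (if e \in W then (if e \in W1 then 1 else p2)
           else (if e \in W1 then 0 else 1 - p2)).
Proof.
pose F e : R := if e \in W then p2 else 0.
pose G e : R := if (e \in W1) == (e \in W) then 1 - p2 else 0.
transitivity (\prod_e (F e + G e)); last first.
  by apply: eq_bigr => e _; rewrite /F /G; case: (e \in W); case: (e \in W1) => /=; lra.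
rewrite bigA_distr [RHS](bigID (fun W2 => W1 :|: W2 == W)) /= [X in _ = _ + X]big1 ?addr0; last first.
  move=> W2 neW; apply/eqP/negPn/negP => /prodf_neq0 nz; case/negP: neW.
  apply/eqP/setP => e; rewrite !inE; move: (nz e isT); rewrite /F /G.
  by case: (e \in W2); case: (e \in W); case: (e \in W1); rewrite //= eqxx.
apply: eq_bigr => W2 /eqP eW; apply: eq_bigr => e _; rewrite /F /G -eW !inE.
by case: (e \in W2); case: (e \in W1).
Qed.

(** This exposes a random set in two independent rounds: the first of the small
    density p1, the second of whatever density is left. *)
Lemma wt_union p1 p2 (phi : {set E} -> R) :
  \sum_W wt (p1 + p2 - p1 * p2) W * phi W =
  \sum_W1 wt p1 W1 * \sum_W2 wt p2 W2 * phi (W1 :|: W2).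
Proof.
transitivity (\sum_W \sum_W1 wt p1 W1 * \sum_(W2 | W1 :|: W2 == W) wt p2 W2 * phi W).
  apply: eq_bigr => W _.
  under eq_bigr => W1 _ do rewrite -mulr_suml sum_wt_union mulrA.
  rewrite -mulr_suml; congr (_ * _).
  pose F e : R := if e \in W then p1 else 0.
  pose G e : R := if e \in W then (1 - p1) * p2 else (1 - p1) * (1 - p2).
  transitivity (\prod_e (F e + G e)).
    by apply: eq_bigr => e _; rewrite /F /G; case: (e \in W); ring.
  rewrite bigA_distr; apply: eq_bigr => W1 _; rewrite /wt -big_split /=.
  by apply: eq_bigr => e _; rewrite /F /G; case: (e \in W); case: (e \in W1); ring.
rewrite exchange_big /=; apply: eq_bigr => W1 _; rewrite -mulr_sumr; congr (_ * _).
rewrite [RHS](partition_big (fun W2 => W1 :|: W2) xpredT) //=.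
by apply: eq_bigr => W _; apply: eq_bigr => W2 /eqP ->.
Qed.

Definition cost (q : R) U : R := \sum_(T in U) q ^+ #|T|.

Definition covers U H := [forall S in H, exists T in U, T \subset S].

(** The minimal fragment of Park and Pham: what W lacks of the member of H that
    is cheapest to complete when S may be used as well. *)
Definition fragment H W S : {set E} :=
  [arg min_(S' < S | (S' \in H) && (S' \subset S :|: W)) #|S' :\: W|] :\: W.

Lemma fragmentP H W S : S \in H ->
  exists S', [/\ S' \in H, S' \subset S :|: W, fragment H W S = S' :\: W &
    forall S'', S'' \in H -> S'' \subset S :|: W -> (#|S' :\: W| <= #|S'' :\: W|)%N].
Proof.
move=> SH; rewrite /fragment; case: arg_minnP => [|S' /andP [S'H sub] min].
  by rewrite SH subsetUl.
by exists S'; split=> // S'' h1 h2; apply: min; rewrite h1.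
Qed.

Lemma fragment_sub H W S : S \in H -> fragment H W S \subset S.
Proof.
case/(fragmentP W) => S' [_ sub -> _]; apply/subsetP => e; rewrite inE => /andP [eW eS].
by have := subsetP sub e eS; rewrite inE (negbTE eW) orbF.
Qed.

Definition large_fragments H m W : {set {set E}} :=
  [set T in [set fragment H W S | S in H] | (m <= #|T|)%N].
Definition small_fragments H m W : {set {set E}} :=
  [set T in [set fragment H W S | S in H] | (#|T| < m)%N].

(** A member of H has a fragment below it, which is large or small; the large
    fragments are paid for now, and only the small ones are passed on. *)
Lemma covers_fragments H m W U :
  covers U (small_fragments H m W) -> covers (large_fragments H m W :|: U) H.
Proof.
move=> /'forall_implyP cU; apply/'forall_implyP => S SH.
have TH : fragment H W S \in [set fragment H W S | S in H] by exact: imset_f.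
have TS := fragment_sub W SH.
case: (ltnP #|fragment H W S| m) => hm.
  have /cU /'exists_andP [T [TU sT]] : fragment H W S \in small_fragments H m W.
    by rewrite inE TH.
  by apply/'exists_andP; exists T; rewrite inE TU orbT (subset_trans sT TS).
by apply/'exists_andP; exists (fragment H W S); rewrite !inE TH hm.
Qed.

(** S0 itself competes in the choice of the fragment, so minimality leaves no
    room outside it.  As S0 can be chosen from the union of W and its fragment
    alone, the pair of W and the fragment is encoded by that union and a subset
    of one member of H. *)
Lemma fragment_encoding H W S S0 : S \in H -> S0 \in H ->
  S0 \subset W :|: fragment H W S -> fragment H W S \subset S0.
Proof.
move=> SH S0H sub; have TS := fragment_sub W SH.
case: (fragmentP W SH) => S' [S'H S'sub eT min].
have S0c : S0 \subset S :|: W.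
  by rewrite (subset_trans sub) // setUC setSU.
have := min _ S0H S0c; rewrite -eT => le.
have sD : S0 :\: W \subset fragment H W S by rewrite subDset.
have /eqP <- : S0 :\: W == fragment H W S by rewrite eqEcard sD.
exact: subsetDl.
Qed.

Lemma wt_add (p : R) W T : 0 < p -> [disjoint W & T] ->
  wt p W = wt p (W :|: T) * ((1 - p) / p) ^+ #|T|.
Proof.
move=> p0 dWT; rewrite -prodr_const /wt [X in _ = _ * X]big_mkcond -big_split /=.
apply: eq_bigr => e _; rewrite !inE.
have := disjointFr dWT; move/(_ e).
case: (e \in W) => [/(_ isT) -> /=|_ /=]; first by rewrite mulr1.
case: (e \in T); last by rewrite mulr1.
by rewrite mulrC divfK // gt_eqF.
Qed.

(** Sum over the encodings of [fragment_encoding]: enlarging W by T multiplies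
    its weight by at least p ^ #|T|, so that T costs at most (q / p) ^ #|T|, and
    one member of H has at most 4 ^ m subsets T. *)
Lemma large_fragments_cost H m (q p : R) :
  0 <= q -> 0 < p -> p <= 1 -> q <= p ->
  (forall S, S \in H -> #|S| < m.*2)%N ->
  \sum_W wt p W * cost q (large_fragments H m W) <= (4 * (q / p)) ^+ m.
Proof.
move=> q0 p0 p1 qp Hm.
have y0 : 0 <= q / p by rewrite divr_ge0 // ltW.
have y1 : q / p <= 1 by rewrite ler_pdivrMr // mul1r.
(* The choice depends on Z only, which is what makes the encoding decodable. *)
pose S0 Z := odflt set0 [pick S in H | S \subset Z].
pose g Z T : R := if [&& T \subset S0 Z, #|S0 Z| < m.*2 & m <= #|T|]%N
  then wt p Z * (q / p) ^+ #|T| else 0.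
have g0 Z T : 0 <= g Z T.
  by rewrite /g; case: ifP => // _; rewrite mulr_ge0 ?exprn_ge0 ?wt_ge0 // ltW.
apply: (@le_trans _ _ (\sum_(W : {set E}) \sum_(T : {set E} | [disjoint W & T]) g (W :|: T) T)).
  apply: ler_sum => W _; rewrite /cost mulr_sumr [leRHS]big_mkcond [leLHS]big_mkcond.
  apply: ler_sum => T _ /=; case: ifP => TL; last by case: ifP.
  move: TL; rewrite inE => /andP [/imsetP [S SH ->] mT].
  set F := fragment H W S in mT *.
  have [S' [S'H _ eF _]] := fragmentP W SH.
  have dWF : [disjoint W & F].
    by rewrite /F eF -setI_eq0 setIDA setIC setDIl setDv setI0.
  rewrite dWF /g /S0; case: pickP => [S1 /andP [S1H S1sub] | /(_ S')] /=; last first.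
    rewrite S'H /F eF; case/negP.
    by rewrite /= -subDset.
  rewrite (fragment_encoding SH S1H S1sub) (Hm _ S1H) mT /=.
  rewrite (wt_add p0 dWF) -mulrA ler_wpM2l ?wt_ge0 ?(ltW p0) //.
  have yE : (1 - p) / p * q = (1 - p) * (q / p) by rewrite mulrAC mulrA.
  rewrite -exprMn yE lerXn2r ?nnegrE // ?mulr_ge0 ?subr_ge0 ?invr_ge0 ?(ltW p0) //.
  by rewrite ler_piMl //; lra.
rewrite (eq_bigr _ (fun W _ => big_mkcond _ _)) /= exchange_big /=.
apply: (@le_trans _ _ (\sum_T \sum_Z g Z T)).
  apply: ler_sum => T _; rewrite -big_mkcond /=.
  pose D := [set W : {set E} | [disjoint W & T]].
  rewrite (eq_bigl (fun W => W \in D)); last by move=> W; rewrite inE.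
  rewrite -(big_imset (fun Z => g Z T)) /=; last first.
    move=> W1 W2; rewrite !inE => d1 d2 e12; apply/setP => e.
    move/setP/(_ e): e12; rewrite !inE.
    case eT: (e \in T); last by rewrite !orbF.
    by rewrite (disjointFl d1 eT) (disjointFl d2 eT).
  by rewrite [leRHS](bigID (fun Z => Z \in [set W :|: T | W in D])) /= lerDl sumr_ge0.
rewrite exchange_big /= (_ : _ ^+ m = \sum_Z wt p Z * (4 * (q / p)) ^+ m); last first.
  by rewrite -mulr_suml sum_wt mul1r.
apply: ler_sum => Z _.
have wZ : 0 <= wt p Z by rewrite wt_ge0 // ltW.
case: (ltnP #|S0 Z| m.*2) => hS; last first.
  rewrite big1 => [|T _]; first by apply: mulr_ge0 => //; apply: exprn_ge0; apply: mulr_ge0.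
  by rewrite /g [(#|S0 Z| < _)%N]ltnNge hS /= andbF.
rewrite /g -big_mkcond /=.
apply: (@le_trans _ _ (\sum_(T in powerset (S0 Z)) wt p Z * (q / p) ^+ m)).
  rewrite big_mkcond [leRHS]big_mkcond /=; apply: ler_sum => T _; rewrite powersetE hS /=.
  case: (T \subset S0 Z) => //=; case: ifP => [mT|_]; last by apply: mulr_ge0 => //; apply: exprn_ge0.
  by rewrite ler_wpM2l // ler_wiXn2l.
rewrite sumr_const card_powerset -(mulr_natl (wt p Z * _)) mulrCA; apply: ler_wpM2l => //.
rewrite [leRHS]exprMn; apply: ler_wpM2r; first by apply: exprn_ge0.
by rewrite -natrX ler_nat -(expnM 2 2) leq_exp2l // mul2n ltnW.
Qed.

Definition avoids H W := [forall S in H, ~~ (S \subset W)].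

(** In each of the r rounds the sizes of the members are halved, by passing to
    the small fragments; a cover of those, together with the large fragments,
    covers H, so the lower bound x on the cost of covers drops only by the
    expected cost of the large fragments.  After r rounds only the empty set can
    remain.  When x = 1 this bounds the probability of failure. *)
Lemma spread_threshold (q p1 : R) (r : nat) H (p x : R) :
  0 <= q -> 0 < p1 -> p1 <= 1 / 2 -> 4 * (q / p1) <= 1 ->
  (forall S, S \in H -> #|S| < 2 ^ r)%N ->
  r%:R * p1 <= p -> p <= 1 ->
  (forall U, covers U H -> x <= cost q U) ->
  \sum_(W | avoids H W) wt p W <= 1 - x + r%:R * (4 * (q / p1)).
Proof.
move=> q0 p10 p12; set c := 4 * (q / p1) => y1; elim: r H p x => [|r IH] H p x Hr rp pl1 xU.
  rewrite mul0r addr0.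
  have p0 : 0 <= p by rewrite (le_trans _ rp) // mul0r.
  case: (set_0Vmem H) => [H0|[S SH]].
    have : x <= cost q set0.
      by apply: xU; apply/'forall_implyP => S; rewrite H0 inE.
    rewrite /cost big_set0 => x0.
    apply: (@le_trans _ _ 1); last by lra.
    rewrite -(sum_wt p) [leRHS](bigID (avoids H)) /= lerDl.
    by apply: sumr_ge0 => W _; apply: wt_ge0.
  have S0 : S = set0 by apply/eqP; rewrite -cards_eq0; have := Hr S SH; rewrite expn0 ltnS leqn0.
  rewrite big1 => [|W /'forall_implyP /(_ S SH)]; last by rewrite S0 sub0set.
  have : x <= cost q [set set0].
    apply: xU; apply/'forall_implyP => S' _; apply/'exists_andP.
    by exists set0; rewrite inE eqxx sub0set.
  by rewrite /cost big_set1 cards0 expr0; lra.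
have p1lt : p1 < 1 by lra.
pose p2 := (p - p1) / (1 - p1).
have d0 : 0 < 1 - p1 by lra.
have pE : p = p1 + p2 - p1 * p2.
  by rewrite /p2; field; rewrite gt_eqF.
have rp' : r%:R * p1 + p1 <= p by move: rp; rewrite -natr1 mulrDl mul1r.
have r0 : 0 <= r%:R * p1 by rewrite mulr_ge0 // ltW.
have p2ge : r%:R * p1 <= p2.
  apply: (@le_trans _ _ (p - p1)); first lra.
  rewrite /p2 ler_pdivlMr // -[leRHS]mulr1 ler_wpM2l; lra.
have p2le : p2 <= 1 by rewrite /p2 ler_pdivrMr // mul1r; lra.
pose m := (2 ^ r)%N.
rewrite pE big_mkcond.
under eq_bigr => W _ do rewrite -[wt _ _]mulr1 -[0](mulr0 (wt (p1 + p2 - p1 * p2) W)) -(fun_if (fun z => wt (p1 + p2 - p1 * p2) W * z)).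
rewrite wt_union.
have step W1 : \sum_W2 wt p2 W2 * (if avoids H (W1 :|: W2) then 1 else 0) <=
    1 - (x - cost q (large_fragments H m W1)) + r%:R * c.
  apply: le_trans (IH (small_fragments H m W1) p2 _ _ p2ge p2le _); first last.
  - move=> U /covers_fragments /xU; rewrite lerBlDr => h; apply: le_trans h _.
    rewrite /cost [leLHS]big_mkcond [X in _ <= X + _]big_mkcond [X in _ <= _ + X]big_mkcond.
    rewrite -big_split /=; apply: ler_sum => T _; rewrite inE.
    have := exprn_ge0 #|T| q0.
    by case: (T \in large_fragments _ _ _); case: (T \in U) => /=; lra.
  - by move=> S; rewrite inE => /andP [].
  rewrite [leRHS]big_mkcond; apply: ler_sum => W2 _.
  have wW : 0 <= wt p2 W2 by apply: wt_ge0 => //; lra.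
  case: ifP => av; last by rewrite mulr0; case: ifP.
  suff -> : avoids (small_fragments H m W1) W2 by rewrite mulr1.
  apply/'forall_implyP => T; rewrite inE => /andP [/imsetP [S SH ->] _].
  apply/negP => sub; have [S' [S'H _ eF _]] := fragmentP W1 SH.
  move/'forall_implyP: av => /(_ S' S'H) /negP; apply.
  by rewrite -subDset -eF.
apply: (@le_trans _ _ (\sum_W1 wt p1 W1 * ((1 - x + r%:R * c) + cost q (large_fragments H m W1)))).
  apply: ler_sum => W1 _; rewrite ler_wpM2l ?wt_ge0 ?(ltW p10) ?(ltW p1lt) //.
  by apply: le_trans (step W1) _; lra.
under eq_bigr => W1 _ do rewrite mulrDr.
rewrite big_split /= -mulr_suml sum_wt mul1r -natr1 mulrDl mul1r.
have y0 : 0 <= q / p1 by rewrite divr_ge0 // ltW.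
suff : \sum_W1 wt p1 W1 * cost q (large_fragments H m W1) <= c by lra.
apply: le_trans (large_fragments_cost q0 p10 (ltW p1lt) _ _) _.
- have : q / p1 <= 1 by rewrite /c in y1; lra.
  by rewrite ler_pdivrMr // mul1r.
- by move=> S /Hr; rewrite /m expnS mul2n.
rewrite -[leRHS]expr1 ler_wiXn2l ?expn_gt0 //.
by apply: mulr_ge0.
Qed.

End Spread.

(** * Random graphs as random sets of edges *)

Section EdgeSets.
Local Open Scope ring_scope.
Variables (R : realType) (V : finType).

Definition edge_type : finType := {E : {set V} | E \in pairs V}.

Lemma graph_of_subproof (W : {set edge_type}) : [set val E | E in W] \subset pairs V.
Proof. by apply/subsetP => E /imsetP [E' _ ->]; apply: valP. Qed.

Definition graph_of W : sgraph V := SGraph (graph_of_subproof W).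

Definition edge_set (S : {set {set V}}) : {set edge_type} := [set E | val E \in S].

Lemma graph_ofK (H : sgraph V) : graph_of (edge_set (edges H)) = H.
Proof.
apply: val_inj => /=; apply/setP => E; apply/imsetP/idP => [[E']|EH].
  by rewrite inE => h ->.
have EP := subsetP (edges_pairs H) E EH.
by exists (Sub E EP); rewrite ?inE SubK.
Qed.

Lemma mem_graph_of W (E : edge_type) : (val E \in edges (graph_of W)) = (E \in W).
Proof. by rewrite /= mem_imset //; apply: val_inj. Qed.

Lemma gnp_prob_edge_sets (p : R) (A : pred (sgraph V)) :
  gnp_prob p A = \sum_(W | A (graph_of W)) wt p W.
Proof.
rewrite /gnp_prob (reindex_onto graph_of (fun H => edge_set (edges H))) /=; last first.
  by move=> H _; exact: graph_ofK.
apply: eq_big => W.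
  rewrite (_ : edge_set _ = W) ?eqxx ?andbT //.
  by apply/setP => E; rewrite inE mem_graph_of.
move=> _; rewrite /gnp_mass big_sub; apply: eq_bigr => E _.
by rewrite mem_graph_of.
Qed.

(** A spread family has no cheap cover: each T of the cover catches at most a
    fraction qs ^ #|T| of the indices.  The r rounds use the density
    8 * r * qs, so that they fail with probability at most 1/2 in total. *)
Lemma gnp_prob_spread (p qs : R) (r : nat) (I : finType) (D : {set I})
    (S : I -> {set {set V}}) (A : pred (sgraph V)) :
  (0 < #|D|)%N -> (1 < r)%N -> 0 < qs -> 8 * r%:R ^+ 2 * qs <= p -> p <= 1 ->
  (forall i, i \in D -> S i \subset pairs V /\ (#|S i| < 2 ^ r)%N) ->
  (forall i H, i \in D -> S i \subset edges H -> A H) ->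
  (forall T : {set {set V}}, #|[set i in D | T \subset S i]|%:R <= qs ^+ #|T| * #|D|%:R) ->
  1 / 2 <= gnp_prob p A.
Proof.
move=> D0 r1 qs0 hp p1 hS hA hspread.
pose H := [set edge_set (S i) | i in D].
have r0 : 0 < r%:R :> R by rewrite ltr0n ltnW.
have r2 : 2 <= r%:R :> R by rewrite ler_nat.
pose p' := 8 * r%:R * qs.
have p'0 : 0 < p' by rewrite /p' !mulr_gt0.
have rp' : r%:R * p' <= p by apply: le_trans hp; rewrite /p' expr2; lra.
have p'2 : p' <= 1 / 2.
  have : 2 * p' <= r%:R * p' by rewrite ler_wpM2r // ltW.
  lra.
have qp : 4 * (qs / p') = (2 * r%:R)^-1.
  by rewrite /p'; field; rewrite !gt_eqF.
have D0' : 0 < #|D|%:R :> R by rewrite ltr0n.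
have cover U : covers U H -> 1 <= cost qs U.
  move=> /'forall_implyP cU; rewrite -(ler_pM2r D0') mul1r /cost mulr_suml.
  apply: (@le_trans _ _ (\sum_(T in U) #|[set i in D | [set val E | E in T] \subset S i]|%:R)); last first.
    apply: ler_sum => T _; apply: le_trans (hspread _) _.
    by rewrite card_imset //; apply: val_inj.
  rewrite -natr_sum ler_nat -[leqLHS]sum1_card.
  under [leqRHS]eq_bigr => T _ do rewrite -sum1_card big_mkcond /=.
  rewrite exchange_big /= big_mkcond /=; apply: leq_sum => i _.
  case: ifP => // iD; have iH : edge_set (S i) \in H by apply: imset_f.
  have /'exists_andP [T [TU sT]] := cU _ iH.
  rewrite (bigD1 T) //= inE iD /= (_ : _ \subset _ = true) //.
  by apply/subsetP => E /imsetP [E' E'T ->]; have := subsetP sT E' E'T; rewrite inE.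
have key := @spread_threshold R edge_type qs p' r H p 1 (ltW qs0) p'0 p'2 _ _ rp' p1 cover.
have {key} : \sum_(W | avoids H W) wt p W <= 1 - 1 + r%:R * (4 * (qs / p')).
  apply: key.
    by rewrite qp invf_le1 ?mulr_gt0 //; lra.
  move=> S' /imsetP [i iD ->]; have [sS cS] := hS i iD; apply: leq_ltn_trans cS.
  rewrite -(card_imset _ (@val_inj _ _ edge_type)); apply: subset_leq_card.
  by apply/subsetP => E /imsetP [E' + ->]; rewrite inE.
rewrite qp invfM mulrCA mulfV ?gt_eqF // mulr1 => fail.
have tot := sum_wt edge_type p; rewrite (bigID (avoids H)) /= in tot.
have p0 : 0 <= p by apply: le_trans rp'; rewrite mulr_ge0 // ltW.
rewrite gnp_prob_edge_sets; apply: (@le_trans _ _ (\sum_(W | ~~ avoids H W) wt p W)); first by lra.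
rewrite big_mkcond [leRHS]big_mkcond /=; apply: ler_sum => W _.
case: ifP => [av|_]; last by case: ifP => // _; apply: wt_ge0.
case: ifP => // /negP; case; move: av; rewrite negb_forall_in => /existsP [S' /andP [S'H]].
rewrite negbK; case/imsetP: S'H => i iD -> sub; apply: (hA i) => //.
apply/subsetP => E ES; have [sS _] := hS i iD; have EP := subsetP sS E ES.
apply/imsetP; exists (Sub E EP); rewrite ?SubK //.
by apply: (subsetP sub); rewrite inE SubK.
Qed.

End EdgeSets.

(** * Almost perfect tilings by complete bipartite graphs *)

Section Tiling.
Local Open Scope nat_scope.
Variables (V : finType) (e : rel V).
Hypothesis e_irr : irreflexive e.
Hypothesis e_sym : symmetric e.
Variables (a b : nat).
Hypothesis a_gt0 : 0 < a.
Hypothesis b_gt0 : 0 < b.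
Let c := a + b.

Implicit Types (X Y L U W A B : {set V}) (P Q : {set {set V} * {set V}}).

Definition nbrs v X := [set y in X | e v y].

Definition supp (T : {set V} * {set V}) := T.1 :|: T.2.

Definition is_tile s (T : {set V} * {set V}) :=
  [&& #|T.1| == s * a, #|T.2| == s * b & [forall x in T.1, forall y in T.2, e x y]].

Definition tiling s X P :=
  (forall T, T \in P -> is_tile s T /\ supp T \subset X) /\
  {in P &, forall T T', T != T' -> [disjoint supp T & supp T']}.

Lemma subset_of_card X n : n <= #|X| -> exists2 Y : {set V}, Y \subset X & #|Y| = n.
Proof.
elim: n => [_|n IH lt]; first by exists set0; rewrite ?sub0set ?cards0.
have [Y YX cY] := IH (ltnW lt).
have /set0Pn [x] : X :\: Y != set0.
  by rewrite -card_gt0 cardsDS // cY subn_gt0.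
rewrite inE => /andP [xY xX]; exists (x |: Y).
  by rewrite subUset sub1set xX.
by rewrite cardsU1 xY cY.
Qed.

Lemma tiling0 s X : tiling s X set0.
Proof. by split=> [T|T T']; rewrite inE. Qed.

Lemma tilingW s X Y P Q : X \subset Y -> Q \subset P -> tiling s X P -> tiling s Y Q.
Proof.
move=> XY QP [tP dP]; split=> [T TQ|T T' TQ T'Q].
  by have [tT sT] := tP T (subsetP QP T TQ); split=> //; apply: subset_trans XY.
by apply: dP; apply: (subsetP QP).
Qed.

Lemma tile_disjoint s T : is_tile s T -> [disjoint T.1 & T.2].
Proof.
case/and3P => _ _ /'forall_implyP h; rewrite -setI_eq0; apply/eqP/setP => x.
rewrite !inE; apply/negP => /andP [x1 x2].
by have /'forall_implyP /(_ x x2) := h x x1; rewrite e_irr.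
Qed.

Lemma card_supp s T : is_tile s T -> #|supp T| = s * c.
Proof.
move=> tT; have := tT; case/and3P => /eqP c1 /eqP c2 _.
rewrite /supp cardsU c1 c2 (_ : _ :&: _ = set0) ?cards0 ?subn0 ?mulnDr //.
by apply/eqP; rewrite setI_eq0 (tile_disjoint tT).
Qed.

Lemma tilingU s X Y P Q : 0 < s -> [disjoint X & Y] ->
  tiling s X P -> tiling s Y Q ->
  tiling s (X :|: Y) (P :|: Q) /\ #|P :|: Q| = #|P| + #|Q|.
Proof.
move=> s0 dXY [tP dP] [tQ dQ].
have dPQ T T' : T \in P -> T' \in Q -> [disjoint supp T & supp T'].
  move=> /tP [_ s1] /tQ [_ s2].
  by apply: disjointWl s1 _; apply: disjointWr s2 _.
split; last first.
  rewrite cardsU (_ : P :&: Q = set0) ?cards0 ?subn0 //.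
  apply/eqP/set0Pn => -[T]; rewrite inE => /andP [TP TQ].
  have := dPQ T T TP TQ; rewrite -setI_eq0 setIid -cards_eq0.
  have [/card_supp -> _] := tP T TP.
  by rewrite muln_eq0 -!leqn0 /c; lia.
split=> [T|T T'].
  rewrite inE => /orP [/tP|/tQ] [tT sT]; split=> //; apply: subset_trans sT _.
    exact: subsetUl.
  exact: subsetUr.
rewrite !inE => /orP [h1|h1] /orP [h2|h2] ne; [exact: dP|exact: dPQ| |exact: dQ].
by rewrite disjoint_sym; apply: dPQ.
Qed.

Definition cover P := \bigcup_(T in P) supp T.

Lemma sum_cover s X P (E : V -> nat) : tiling s X P ->
  \sum_(v in cover P) E v = \sum_(T in P) \sum_(v in supp T) E v.
Proof.
move=> [_ dP]; pose F T := if T \in P then supp T else set0.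
have -> : cover P = \bigcup_T F T by rewrite /cover big_mkcond.
rewrite partition_disjoint_bigcup /=.
  rewrite [RHS]big_mkcond /=; apply: eq_bigr => T _; rewrite /F; case: ifP => // _.
  by rewrite big_set0.
move=> T T' ne; rewrite /F; case: ifP => TP; last by rewrite -setI_eq0 set0I.
by case: ifP => T'P; [exact: dP|rewrite -setI_eq0 setI0].
Qed.

Lemma card_cover_tiling s X P : tiling s X P -> #|cover P| = #|P| * (s * c).
Proof.
move=> tP; rewrite -sum1_card (sum_cover _ tP) -sum_nat_const.
by apply: eq_bigr => T TP; rewrite sum1_card; have [/card_supp -> _] := tP.1 T TP.
Qed.

Lemma card_nbrs_cover s X P v : tiling s X P ->
  #|nbrs v (cover P)| = \sum_(T in P) #|nbrs v (supp T)|.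
Proof.
move=> tP; have nE Y : #|nbrs v Y| = \sum_(y in Y) e v y.
  rewrite -sum1_card big_mkcond [RHS]big_mkcond /=; apply: eq_bigr => y _.
  by rewrite inE; case: (y \in Y); case: (e v y).
by rewrite nE (sum_cover _ tP); apply: eq_bigr => T _; rewrite nE.
Qed.

(** Only the sizes of the sides matter in a complete pair, so that it contains as
    many tiles as they allow. *)
Lemma harvest s n A B : 0 < s ->
  [forall x in A, forall y in B, e x y] -> n * (s * a) <= #|A| -> n * (s * b) <= #|B| ->
  exists P, tiling s (A :|: B) P /\ #|P| = n.
Proof.
move=> s0; elim: n A B => [|n IH] A B cAB hA hB.
  by exists set0; split; [exact: tiling0|rewrite cards0].
have [A1 sA1 cA1] : exists2 A1 : {set V}, A1 \subset A & #|A1| = s * a.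
  by apply: subset_of_card; apply: leq_trans hA; rewrite leq_pmull.
have [B1 sB1 cB1] : exists2 B1 : {set V}, B1 \subset B & #|B1| = s * b.
  by apply: subset_of_card; apply: leq_trans hB; rewrite leq_pmull.
have cAB' A' B' : A' \subset A -> B' \subset B -> [forall x in A', forall y in B', e x y].
  move=> sA' sB'; apply/'forall_implyP => x xA'; apply/'forall_implyP => y yB'.
  have /'forall_implyP /(_ x (subsetP sA' x xA')) := cAB.
  by move/'forall_implyP => /(_ y (subsetP sB' y yB')).
have t1 : is_tile s (A1, B1) by rewrite /is_tile /= cA1 cB1 !eqxx cAB'.
have [||| P [tP cP]] := IH (A :\: A1) (B :\: B1).
- by apply: cAB'; apply: subsetDl.
- by rewrite cardsDS // cA1 leq_subRL; lia.
- by rewrite cardsDS // cB1 leq_subRL; lia.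
have t1' : tiling s (A1 :|: B1) [set (A1, B1)].
  split=> [T|T T']; rewrite !inE; first by move=> /eqP ->.
  by move=> /eqP -> /eqP ->; rewrite eqxx.
have dj : [disjoint A1 :|: B1 & (A :\: A1) :|: (B :\: B1)].
  have dAB : forall x, x \in A -> x \in B -> False.
    move=> x xA xB; have /'forall_implyP /(_ x xA) := cAB.
    by move/'forall_implyP => /(_ x xB); rewrite e_irr.
  rewrite -setI_eq0; apply/eqP/setP => x; rewrite !inE.
  have := dAB x; have := subsetP sA1 x; have := subsetP sB1 x.
  by case: (x \in A1); case: (x \in B1); case: (x \in A); case: (x \in B) => //= h1 h2 h3;
     exfalso; auto.
have [tU cU] := tilingU s0 dj t1' tP.
exists ([set (A1, B1)] :|: P); split; last by rewrite cU cP cards1.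
apply: tilingW tU => //; rewrite !subUset !subsetU ?sA1 ?sB1 ?orbT //.
all: by rewrite ?subsetDl ?orbT.
Qed.

(** Pigeonhole over the 2 ^ #|Y| possible neighbourhoods in Y, after discarding
    the vertices of L with fewer than w neighbours there. *)
Lemma common_nbrs L Y w w' : 0 < w' -> 0 < #|L| ->
  #|L| * (w + w') <= \sum_(v in L) #|nbrs v Y| ->
  exists2 W : {set V}, W \subset Y /\ w <= #|W| &
    #|L| * w' <= #|[set v in L | W \subset nbrs v Y]| * (2 ^ #|Y| * #|Y|).
Proof.
move=> w'0 L0 hsum.
pose g := [set v in L | w <= #|nbrs v Y|].
have gE : #|L| * w' <= #|g| * #|Y|.
  have : \sum_(v in L) #|nbrs v Y| <= #|g| * #|Y| + #|L| * w.
    rewrite (bigID (fun v => w <= #|nbrs v Y|)) /=; apply: leq_add.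
      rewrite -sum_nat_const; under [leqRHS]eq_bigl => v do rewrite inE.
      apply: leq_sum => v _; apply: subset_leq_card; apply/subsetP => y.
      by rewrite inE => /andP [].
    rewrite -sum_nat_const big_mkcondr /=; apply: leq_sum => v _.
    by case: ifP => //; rewrite -ltnNge => /ltnW.
  by lia.
have : \sum_(W in powerset Y) #|[set v in g | nbrs v Y == W]| = #|g|.
  rewrite -[RHS]sum1_card (partition_big (fun v => nbrs v Y) (mem (powerset Y))) /=.
    by apply: eq_bigr => W _; rewrite -sum1_card; apply: eq_bigl => v; rewrite inE.
  by move=> v _; rewrite powersetE; apply/subsetP => y; rewrite inE => /andP [].
move=> sumg.
have [W WY hW] : exists2 W : {set V}, W \in powerset Y &
    #|g| <= #|[set v in g | nbrs v Y == W]| * 2 ^ #|Y|.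
  apply/exists_inP; apply: contraT; rewrite negb_exists_in => /forall_inP hall.
  have gpos : 0 < #|g| by move: gE; case: #|g| => //; rewrite mul0n leqNgt muln_gt0 L0 w'0.
  suff : #|g| * 2 ^ #|Y| < #|g| * 2 ^ #|Y| by rewrite ltnn.
  rewrite -{1}sumg big_distrl /= mulnC -card_powerset -sum_nat_const.
  have : 0 < #|powerset Y| by rewrite card_powerset expn_gt0.
  rewrite card_gt0 => /set0Pn [W0 W0Y].
  rewrite (bigD1 W0) //= [X in _ < X](bigD1 W0) //= -addSn leq_add //.
    by rewrite ltnNge card_powerset; apply: hall.
  apply: leq_sum => W /andP [WY _]; rewrite leq_eqVlt; apply/orP; right.
  by rewrite ltnNge card_powerset; apply: hall.
have gW : 0 < #|[set v in g | nbrs v Y == W]|.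
  move: hW gE; case: #|[set v in g | nbrs v Y == W]| => // hg.
  have -> : #|g| = 0 by lia.
  by rewrite mul0n leqNgt muln_gt0 L0 w'0.
exists W; first split.
- by rewrite -powersetE.
- move: gW; rewrite card_gt0 => /set0Pn [v]; rewrite !inE => /andP [/andP [_ h] /eqP <-] //.
apply: leq_trans gE _; rewrite mulnA leq_mul2r; apply/orP; right.
apply: leq_trans hW _; rewrite leq_mul2r; apply/orP; right.
apply: subset_leq_card; apply/subsetP => v; rewrite !inE.
by move=> /andP [/andP [-> _] /eqP ->] /=.
Qed.

Lemma cover_sub P Q : P \subset Q -> cover P \subset cover Q.
Proof.
move=> PQ; apply/bigcupsP => T TP; apply: bigcup_sup.
exact: (subsetP PQ).
Qed.

Lemma cover_subset s X P : tiling s X P -> cover P \subset X.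
Proof. by move=> [tP _]; apply/bigcupsP => T /tP []. Qed.

Lemma tiling_cover s X P : tiling s X P -> tiling s (cover P) P.
Proof.
move=> [tP dP]; split=> // T TP; have [tT _] := tP T TP; split=> //.
exact: bigcup_sup.
Qed.

Lemma cover_setD s X P Q : tiling s X P -> Q \subset P -> cover (P :\: Q) = cover P :\: cover Q.
Proof.
move=> [_ dP] QP; apply/setP => x; rewrite inE; apply/bigcupP/andP => [[T]|[]].
  rewrite inE => /andP [TQ TP] xT; split; last by apply/bigcupP; exists T.
  apply/negP => /bigcupP [T' T'Q xT'].
  have ne : T != T' by apply: contraNneq TQ => ->.
  by have := disjointFl (dP T T' TP (subsetP QP _ T'Q) ne) xT'; rewrite xT.
move=> xQ /bigcupP [T TP xT]; exists T => //; rewrite inE TP andbT.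
by apply: contra xQ => TQ; apply/bigcupP; exists T.
Qed.

Lemma card_nbrsU v X Y : #|nbrs v (X :|: Y)| <= #|nbrs v X| + #|nbrs v Y|.
Proof.
apply: leq_trans (leq_card_setU _ _); apply: subset_leq_card.
by apply/subsetP => y; rewrite !inE andb_orl.
Qed.

Lemma card_nbrs v X : #|nbrs v X| <= #|X|.
Proof. by apply: subset_leq_card; apply/subsetP => y; rewrite inE => /andP []. Qed.

Lemma sum_nbrsC X Y : \sum_(v in X) #|nbrs v Y| = \sum_(y in Y) #|nbrs y X|.
Proof.
have nE v Z : #|nbrs v Z| = \sum_(y in Z) e v y.
  rewrite -sum1_card big_mkcond [RHS]big_mkcond /=; apply: eq_bigr => y _.
  by rewrite inE; case: (y \in Z); case: (e v y).
under eq_bigr => v _ do rewrite nE.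
rewrite exchange_big; apply: eq_bigr => y _; rewrite nE.
by apply: eq_bigr => v _; rewrite e_sym.
Qed.

Lemma complete_common W L Y :
  [forall x in W, forall y in [set v in L | W \subset nbrs v Y], e x y].
Proof.
apply/'forall_implyP => x xW; apply/'forall_implyP => y; rewrite inE => /andP [_ sW].
by have := subsetP sW x xW; rewrite inE e_sym => /andP [].
Qed.

Lemma completeW A B A' B' : A' \subset A -> B' \subset B ->
  [forall x in A, forall y in B, e x y] -> [forall x in A', forall y in B', e x y].
Proof.
move=> sA sB /'forall_implyP cAB.
apply/'forall_implyP => x xA'; apply/'forall_implyP => y yB'.
by have /'forall_implyP /(_ y (subsetP sB _ yB')) := cAB x (subsetP sA _ xA').
Qed.

(** Many vertices of large degree inside L give, by pigeonhole, a common
    neighbourhood large enough for a tile. *)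
Lemma dense_tile s L m K : 0 < s -> #|L| <= m -> 0 < K -> 16 * K <= m ->
  let z := 16 * K * (s * a).+1 in
  s * b * (2 ^ z * z) <= #|L| -> 0 < #|L| ->
  z <= #|[set v in L | m %/ (8 * K) <= #|nbrs v L|]| ->
  exists2 P, tiling s L P & #|P| = 1.
Proof.
move=> s0 Lm K0 mK z hL L0 hD; set h := m %/ _ in hD.
have [Y YD cY] := subset_of_card hD.
have YL : Y \subset L.
  by apply: subset_trans YD _; apply/subsetP => v; rewrite inE => /andP [].
have hm : m <= h * (16 * K).
  have := divn_eq m (8 * K); have := ltn_pmod m (_ : 0 < 8 * K).
  by rewrite -/h muln_gt0 K0 => /(_ isT); lia.
have sumY : #|L| * (s * a + 1) <= \sum_(v in L) #|nbrs v Y|.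
  rewrite sum_nbrsC; apply: (@leq_trans (\sum_(y in Y) h)); last first.
    by apply: leq_sum => y /(subsetP YD); rewrite inE => /andP [].
  rewrite sum_nat_const cY /z addn1; apply: (@leq_trans (m * (s * a).+1)).
    by rewrite leq_mul2r Lm orbT.
  have : m * (s * a).+1 <= h * (16 * K) * (s * a).+1 by rewrite leq_mul2r hm orbT.
  by lia.
have [W [WY cW]] := common_nbrs (ltn0Sn 0) L0 sumY.
rewrite muln1 cY => hc.
set B := [set v in L | W \subset nbrs v Y] in hc.
have z0 : 0 < 2 ^ z * z by rewrite muln_gt0 expn_gt0 /= /z; lia.
have cB : s * b <= #|B|.
  by rewrite -(leq_pmul2r z0); apply: leq_trans hc.
have [||P [tP cP]] := harvest (n := 1) s0 (complete_common W L Y); rewrite ?mul1n //.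
exists P => //; apply: tilingW tP => //; rewrite subUset (subset_trans WY YL) /=.
by apply/subsetP => v; rewrite inE => /andP [].
Qed.

(** The exchange behind the tiling theorem.  As W exceeds the small side by
    s * a elements, it meets the large side in at least s * a vertices; these and
    further vertices of W form the small side Q of a new tile whose large side is
    in L.  So many vertices of the old small side are left over that, with the
    rest of the large side, they contain one more tile of scale s. *)
Lemma rebuild_tile s th T L W : 0 < s -> 0 < th -> th * a + b <= th * b ->
  is_tile (th * s) T -> [disjoint supp T & L] -> W \subset supp T ->
  (th * s) * a + s * a <= #|W| ->
  th * s * b <= #|[set v in L | W \subset nbrs v (supp T)]| ->
  exists P L1, [/\ tiling s (supp T :|: L1) P, L1 \subset L,
    #|L1| = th * s * b & #|P| = th.+1].
Proof.
move=> s0 th0 hab tT dTL WT cW hB; have dT := tile_disjoint tT.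
have := tT; case/and3P => /eqP cA /eqP cB cAB.
set A := T.1 in cA cAB dT; set B := T.2 in cB cAB dT.
have [L1 sL1 cL1] := subset_of_card hB.
have L1L : L1 \subset L.
  by apply: subset_trans sL1 _; apply/subsetP => v; rewrite inE => /andP [].
have cWB : s * a <= #|W :&: B|.
  have : #|W| <= #|W :&: A| + #|W :&: B|.
    apply: leq_trans (leq_card_setU _ _); apply: subset_leq_card.
    by rewrite -setIUr subsetI subxx.
  have : #|W :&: A| <= #|A| by apply: subset_leq_card; apply: subsetIr.
  lia.
(* Q0 uses the large side, which saves s * a vertices of the small side. *)
have [Q0 sQ0 cQ0] := subset_of_card cWB.
have Q0W : Q0 \subset W by apply: subset_trans sQ0 _; apply: subsetIl.
have Q0B : Q0 \subset B by apply: subset_trans sQ0 _; apply: subsetIr.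
have [|Q1 sQ1 cQ1] := @subset_of_card (W :\: Q0) (th * s * a - s * a).
  by rewrite cardsDS // cQ0 leq_sub2r // (leq_trans _ cW) // leq_addr.
pose Q := Q0 :|: Q1.
have sa_le : s * a <= th * s * a by rewrite -mulnA leq_pmull.
have cQ : #|Q| = th * s * a.
  rewrite /Q cardsU (_ : Q0 :&: Q1 = set0) ?cards0; first by rewrite cQ0 cQ1 subn0 subnKC.
  apply/setP => x; rewrite !inE; apply/negP => /andP [x0 /(subsetP sQ1)].
  by rewrite inE x0.
have QW : Q \subset W.
  by rewrite subUset Q0W (subset_trans sQ1 (subsetDl _ _)).
have cAQ : s * a <= #|A :\: Q|.
  have : #|A :&: Q| <= #|Q1|.
    apply: subset_leq_card; apply/subsetP => x; rewrite !inE => /andP [xA /orP []] //.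
    by move=> /(subsetP Q0B) xB; have := disjointFr dT xA; rewrite xB.
  by rewrite cardsD cA cQ1; move: sa_le; clear; lia.
have cBQ : s * b <= #|B :\: Q|.
  have : #|B :&: Q| <= #|Q| by apply: subset_leq_card; apply: subsetIr.
  have : s * (th * a + b) <= s * (th * b) by rewrite leq_mul2l hab orbT.
  by rewrite cardsD cB cQ; clear; lia.
have [||P1 [tP1 cP1]] := harvest (n := th) s0 (completeW QW sL1 (complete_common W L (supp T))).
- by rewrite cQ mulnA.
- by rewrite cL1 mulnA.
have [||P2 [tP2 cP2]] := harvest (n := 1) s0 (completeW (subsetDl A Q) (subsetDl B Q) cAB).
- by rewrite mul1n.
- by rewrite mul1n.
have dj : [disjoint Q :|: L1 & (A :\: Q) :|: (B :\: Q)].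
  rewrite -setI_eq0; apply/eqP/setP => x; rewrite !inE; apply/negP.
  case/andP => /orP [xQ|xL1]; first by rewrite xQ.
  have : x \notin supp T by rewrite (disjointFl dTL (subsetP L1L _ xL1)).
  rewrite inE negb_or => /andP [/negbTE xA /negbTE xB].
  by rewrite -/A -/B xA xB !andbF.
have [tP cP] := tilingU s0 dj tP1 tP2.
exists (P1 :|: P2), L1; split=> //; last by rewrite cP cP1 cP2 addn1.
apply: tilingW tP => //.
have sT : supp T \subset supp T :|: L1 by apply: subsetUl.
apply/subUsetP; split; apply/subUsetP; split.
- exact: subset_trans (subset_trans QW WT) sT.
- exact: subsetUr.
- by apply: subset_trans sT; apply: subset_trans (subsetDl _ _) (subsetUl _ _).
- by apply: subset_trans sT; apply: subset_trans (subsetDl _ _) (subsetUr _ _).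
Qed.

(** Size of the uncovered part that makes both pigeonhole steps effective. *)
Definition leftover_bound s th K :=
  let z := 16 * K * (s * a).+1 in let t := th * s * c in
  16 * K + 2 * z + s * b * (2 ^ z * z) + 2 * (t * (2 ^ t * t)).

(** Vertices of L have few neighbours in L and in the waste outside the tiles, so
    that on average they are joined to more than the proportion a / c of the
    tiles; some tile T attains the average. *)
Lemma sparse_tile s th K U P L X :
  0 < s -> 0 < th -> 0 < K -> 4 * K * a <= th * c ->
  tiling (th * s) X P -> cover P \subset U -> L \subset U -> [disjoint cover P & L] ->
  (forall v, v \in L -> (a * K + c) * #|U| <= #|nbrs v U| * (c * K)) ->
  8 * K * #|U :\: (cover P :|: L)| <= #|U| ->
  let h := #|U| %/ (8 * K) in
  (forall v, v \in L -> #|nbrs v L| <= h) ->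
  0 < #|L| ->
  exists2 T, T \in P &
   #|L| * ((th * s * a + s * a) + s * a) <= \sum_(v in L) #|nbrs v (supp T)|.
Proof.
move=> s0 th0 K0 hth tP PU LU dPL degL waste h hL L0.
set g := _ + s * a.
have degP v : v \in L -> (4 * a * K + 2 * c) * #|U| < #|nbrs v (cover P)| * (4 * c * K).
  move=> vL; have := degL v vL; have := hL v vL.
  have hE : h * (8 * K) <= #|U| by exact: leq_trunc_div.
  have : #|nbrs v U| <= #|nbrs v (cover P)| + #|nbrs v L| + #|U :\: (cover P :|: L)|.
    apply: (@leq_trans (#|nbrs v (cover P)| + #|nbrs v L| + #|nbrs v (U :\: (cover P :|: L))|)).
      apply: leq_trans (leq_add (card_nbrsU _ _ _) (leqnn _)).
      apply: leq_trans (card_nbrsU _ _ _).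
      apply: subset_leq_card; apply/subsetP => y; rewrite !inE => /andP [-> ->].
      by rewrite !andbT; case: (y \in cover P); case: (y \in L).
    by rewrite leq_add2l card_nbrs.
  set dU := #|nbrs v U|; set dP := #|nbrs v (cover P)|; set dL := #|nbrs v L|.
  set w := #|_ :\: _|.
  move=> h1 h2 h3.
  have U0 : 0 < #|U| by rewrite (leq_trans L0) // subset_leq_card.
  have c0 : 0 < c by rewrite /c; lia.
  have e1 : dU * (4 * c * K) <= (dP + h + w) * (4 * c * K) by rewrite leq_mul2r; lia.
  have e2 : c * (h * (8 * K)) <= c * #|U| by rewrite leq_mul2l hE orbT.
  have e3 : c * (8 * K * w) <= c * #|U| by rewrite leq_mul2l waste orbT.
  have e4 : 0 < c * #|U| by rewrite muln_gt0 c0 U0.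
  by lia.
apply/exists_inP; apply: contraT; rewrite negb_exists_in => /forall_inP hall.
have Pn0 : 0 < #|P|.
  case: (posnP #|P|) => // /eqP; rewrite cards_eq0 => /eqP P0.
  move: L0; rewrite card_gt0 => /set0Pn [v /degP].
  rewrite (_ : nbrs v (cover P) = set0) ?cards0 ?mul0n //.
  by apply/setP => y; rewrite !inE P0 /cover big_set0 inE.
have hsum : \sum_(v in L) #|nbrs v (cover P)| <= #|P| * (#|L| * g).
  under eq_bigr => v _ do rewrite (card_nbrs_cover _ tP).
  rewrite exchange_big /=; apply: (@leq_trans (\sum_(T in P) #|L| * g)); last first.
    by rewrite sum_nat_const.
  by apply: leq_sum => T TP; rewrite ltnW // ltnNge; apply: hall.
have hlow : #|L| * ((4 * a * K + 2 * c) * #|U|) < (\sum_(v in L) #|nbrs v (cover P)|) * (4 * c * K).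
  rewrite big_distrl /= -sum_nat_const.
  move: L0; rewrite card_gt0 => /set0Pn [v0 v0L].
  rewrite (bigD1 v0) //= [X in _ < X](bigD1 v0) //= -addSn leq_add ?degP //.
  by apply: leq_sum => v /andP [vL _]; apply: ltnW; apply: degP.
have PU' : #|P| * (th * s * c) <= #|U|.
  by rewrite -(card_cover_tiling tP) subset_leq_card.
have gE : g * (4 * K) <= th * s * (4 * a * K + 2 * c).
  have : s * (4 * K * a) <= s * (th * c) by rewrite leq_mul2l hth orbT.
  by rewrite /g; lia.
have f1 : (\sum_(v in L) #|nbrs v (cover P)|) * (4 * c * K) <= #|P| * (#|L| * g) * (4 * c * K).
  by rewrite leq_mul2r hsum orbT.
have f2 : (#|P| * #|L| * c) * (g * (4 * K)) <= (#|P| * #|L| * c) * (th * s * (4 * a * K + 2 * c)).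
  by rewrite leq_mul2l gE orbT.
have f3 : #|L| * (4 * a * K + 2 * c) * (#|P| * (th * s * c)) <= #|L| * (4 * a * K + 2 * c) * #|U|.
  by rewrite leq_mul2l PU' orbT.
by lia.
Qed.

(** One exchange step: either L is dense and contains a new tile, or some tile is
    rebuilt; both gain one tile of scale s and use a bounded part of L. *)
Lemma improve s th K U P L X :
  0 < s -> 0 < th -> 0 < K -> 4 * K * a <= th * c -> th * a + b <= th * b ->
  tiling (th * s) X P -> cover P \subset U -> L \subset U -> [disjoint cover P & L] ->
  (forall v, v \in L -> (a * K + c) * #|U| <= #|nbrs v U| * (c * K)) ->
  16 * K * #|U :\: (cover P :|: L)| + 16 * K * leftover_bound s th K <= #|U| ->
  leftover_bound s th K <= #|L| ->
  exists P' L1 Q, [/\ P' \subset P, L1 \subset L, #|L1| <= th * s * c,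
    tiling s (cover (P :\: P') :|: L1) Q &
    #|Q| + th * #|P'| = th * #|P| + 1 /\ #|P :\: P'| <= 1].
Proof.
move=> s0 th0 K0 hth hab tP PU LU dPL degL waste big.
have LUc : #|L| <= #|U| by apply: subset_leq_card.
pose z := 16 * K * (s * a).+1; pose t := th * s * c.
have c0 : 0 < c by rewrite /c; lia.
have t0 : 0 < t by rewrite !muln_gt0 th0 s0 c0.
have tt0 : 0 < 2 ^ t * t by rewrite muln_gt0 expn_gt0 t0.
have z0 : 0 < z by rewrite /z; lia.
move: big waste; rewrite /leftover_bound -/z -/t => big waste.
pose D := [set v in L | #|U| %/ (8 * K) <= #|nbrs v L|].
case: (leqP z #|D|) => hD.
  have [|||Q tQ cQ] := @dense_tile s L #|U| K s0 LUc K0 _ _ _ hD.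
  - by lia.
  - by rewrite -/z; lia.
  - by lia.
  have QL := cover_subset tQ.
  exists P, (cover Q), Q; split=> //.
  - by rewrite (card_cover_tiling tQ) cQ mul1n /t -mulnA leq_pmull.
  - by apply: tilingW (tiling_cover tQ) => //; apply: subsetUr.
  - by rewrite cQ addnC setDv cards0.
(* The few vertices of large degree inside L are set aside. *)
pose L0 := L :\: D.
have DL : D \subset L by apply/subsetP => v; rewrite inE => /andP [].
have L0L : L0 \subset L by apply: subsetDl.
have cL0 : #|L0| = #|L| - #|D| by rewrite cardsDS.
have wasteD : #|U :\: (cover P :|: L0)| <= #|U :\: (cover P :|: L)| + #|D|.
  apply: leq_trans (leq_card_setU _ _); apply: subset_leq_card.
  apply/subsetP => v; rewrite !inE.
  by case: (v \in U); case: (v \in cover P); case: (v \in L); case: (_ <= _).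
have [|||||T TP hT] := sparse_tile s0 th0 K0 hth tP PU (subset_trans L0L LU) (L := L0).
- by apply: disjointWr L0L dPL.
- by move=> v /(subsetP L0L); apply: degL.
- by nia.
- move=> v; rewrite !inE => /andP []; case vL: (v \in L) => //=.
  rewrite -ltnNge => /ltnW h1 _; apply: leq_trans h1; apply: subset_leq_card.
  by apply/subsetP => y; rewrite !inE => /andP [/andP [_ ->] ->].
- by lia.
have [tT _] := tP.1 T TP.
have TC : supp T \subset cover P by apply: bigcup_sup.
have L0p : 0 < #|L0| by rewrite cL0; move: hD big; clear; lia.
have sa0 : 0 < s * a by rewrite muln_gt0 s0.
have [W [WT cW] hW] := common_nbrs sa0 L0p hT.
have [||P1 [L1 [tP1 L1L0 cL1 cP1]]] := rebuild_tile s0 th0 hab tT _ WT cW (L := L0).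
- by apply: disjointWl TC _; apply: disjointWr L0L dPL.
- move: hW; rewrite (card_supp tT) -/t => hW.
  rewrite -(leq_pmul2r tt0); apply: leq_trans hW.
  have : t * (2 ^ t * t) <= #|L0| by rewrite cL0; move: hD big; clear; lia.
  have : th * s * b * (2 ^ t * t) <= t * (2 ^ t * t).
    by rewrite leq_mul2r /t /c mulnDr leq_addl orbT.
  have : #|L0| <= #|L0| * (s * a) by rewrite leq_pmulr.
  by clear; lia.
have PD : P :\: (P :\ T) = [set T].
  by apply/setP => T'; rewrite !inE; case: eqP => [->|]; rewrite ?TP //=; case: (T' \in P).
exists (P :\ T), L1, P1; split.
- exact: subD1set.
- exact: subset_trans L0L.
- by rewrite cL1 /t /c mulnDr leq_addl.
- apply: tilingW tP1 => //; rewrite PD /cover big_set1; exact: subxx.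
- by rewrite PD cards1 cP1 (cardsD1 T P) TP; clear; lia.
Qed.

Lemma cover_disjoint s X P P1 : tiling s X P -> P1 \subset P ->
  [disjoint cover (P :\: P1) & cover P1].
Proof.
move=> tP P1P; rewrite (cover_setD tP P1P) -setI_eq0.
by apply/eqP/setP => x; rewrite !inE; case: (x \in cover P1); rewrite ?andbF.
Qed.

Lemma improve_iter s th K U P i :
  0 < s -> 0 < th -> 0 < K -> 4 * K * a <= th * c -> th * a + b <= th * b ->
  tiling (th * s) U P ->
  (forall v, v \in U -> (a * K + c) * #|U| <= #|nbrs v U| * (c * K)) ->
  let L := U :\: cover P in
  16 * K * (2 * i * (th * s * c)) + 16 * K * leftover_bound s th K <= #|U| ->
  leftover_bound s th K + i * (th * s * c) <= #|L| ->
  exists P' L' Q, [/\ P' \subset P, L' \subset L, #|L :\: L'| <= i * (th * s * c),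
    tiling s (cover (P :\: P') :|: (L :\: L')) Q &
    #|Q| + th * #|P'| = th * #|P| + i /\ #|P :\: P'| <= i].
Proof.
move=> s0 th0 K0 hth hab tP degU L; set t := th * s * c.
have PU := cover_subset tP.
elim: i => [|i IH] bigU bigL.
  exists P, L, set0; rewrite subxx; split=> //.
  - by rewrite setDv cards0.
  - exact: tiling0.
  - by rewrite setDv !cards0 !addn0.
have [||P' [L' [Q [P'P L'L cL tQ [cQ cP]]]]] := IH; [by nia|by lia|].
have LU : L \subset U by apply: subsetDl.
have cLL' : #|L :\: L'| = #|L| - #|L'| by rewrite cardsDS.
have dPL' : [disjoint cover P & L'].
  by apply: disjointWr L'L _; rewrite -setI_eq0 setIDA setIC setDIl setDv setI0.
have tP' : tiling (th * s) U P' by apply: tilingW tP.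
have cov' : cover P' \subset cover P by apply: cover_sub.
have wasteE : U :\: (cover P' :|: L') \subset (cover (P :\: P')) :|: (L :\: L').
  apply/subsetP => x; rewrite (cover_setD tP P'P) !inE.
  by case: (x \in cover P'); case: (x \in L'); case: (x \in U); case: (x \in cover P).
have waste : #|U :\: (cover P' :|: L')| <= 2 * i * t.
  apply: leq_trans (subset_leq_card wasteE) _; apply: leq_trans (leq_card_setU _ _) _.
  have tPP : tiling (th * s) U (P :\: P') by apply: tilingW tP => //; apply: subsetDl.
  have : #|P :\: P'| * t <= i * t by rewrite leq_mul2r cP orbT.
  rewrite (card_cover_tiling tPP) -/t; lia.
have [|||||P2 [L1 [Q1 [P2P' L1L' cL1 tQ1 [cQ1 cP2]]]]] :=
    improve s0 th0 K0 hth hab tP' _ (subset_trans L'L LU) (L := L').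
- exact: cover_subset tP'.
- by apply: disjointWl cov' dPL'.
- by move=> v /(subsetP L'L) /(subsetP LU); apply: degU.
- have : 16 * K * #|U :\: (cover P' :|: L')| <= 16 * K * (2 * i * t) by rewrite leq_mul2l waste orbT.
  by lia.
- by move: bigL cL; rewrite cLL'; lia.
have dj : [disjoint cover (P :\: P') :|: (L :\: L') & cover (P' :\: P2) :|: L1].
  have dc := cover_disjoint tP P'P.
  rewrite -setI_eq0; apply/eqP/setP => x; rewrite !inE; apply/negP.
  have s1 : x \in L1 -> x \in L' by apply: (subsetP L1L').
  have s2 : x \in L' -> x \in L by apply: (subsetP L'L).
  have s3 : x \in cover (P' :\: P2) -> x \in cover P'.
    by apply: (subsetP (cover_sub (subsetDl _ _))).
  have s4 : x \in cover P' -> x \in cover P by apply: (subsetP cov').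
  have s5 : x \in cover (P :\: P') -> x \in cover P.
    by apply: (subsetP (cover_sub (subsetDl _ _))).
  have s6 : x \in cover P -> x \in L = false by rewrite !inE => ->.
  have s7 : x \in cover (P :\: P') -> x \in cover P' = false by apply: (disjointFr dc).
  case/andP => /orP [y1|/andP [y1 y2]] /orP [y3|y3].
  - by have := s7 y1; rewrite s3.
  - by have := s6 (s5 y1); rewrite s2 // s1.
  - by move: y2; rewrite (s4 (s3 y3)).
  - by move: y1; rewrite s1.
have [tU cU] := tilingU s0 dj tQ tQ1.
exists P2, (L' :\: L1), (Q :|: Q1); split.
- exact: subset_trans P2P' P'P.
- exact: subset_trans (subsetDl _ _) L'L.
- rewrite cardsDS; last by apply: subset_trans (subsetDl _ _) L'L.
  have : #|L'| <= #|L| by apply: subset_leq_card.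
  by rewrite cardsDS //; move: cL1 cL; rewrite cLL' -/t; clear; lia.
- apply: tilingW tU => //; apply/subUsetP; split; apply/subUsetP; split.
  + by apply: subset_trans (subsetUl _ _); apply: cover_sub; apply: setDS.
  + apply: subset_trans (subsetUr _ _); apply: setDS; exact: subsetDl.
  + by apply: subset_trans (subsetUl _ _); apply: cover_sub; apply: setSD.
  + apply: subset_trans (subsetUr _ _); apply/subsetP => x xL1.
    by rewrite in_setD in_setD xL1 /=; apply: (subsetP L'L); apply: (subsetP L1L').
rewrite cU; have := cQ; have := cQ1.
have : #|P :\: P2| <= #|P :\: P'| + #|P' :\: P2|.
  apply: leq_trans (leq_card_setU _ _); apply: subset_leq_card; apply/subsetP => x.
  by rewrite !inE; case: (x \in P'); case: (x \in P2); case: (x \in P).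
by move: cP cP2; clear; split; lia.
Qed.

Lemma split_tiling s th X P : 0 < s -> tiling (th * s) X P ->
  exists Q, tiling s (cover P) Q /\ #|Q| = th * #|P|.
Proof.
move=> s0; have [n] := ubnP #|P|; elim: n P => // n IH P ltn tP.
case: (set_0Vmem P) => [->|[T TP]].
  by exists set0; rewrite !cards0 muln0; split=> //; apply: tiling0.
have [|Q1 [tQ1 cQ1]] := IH (P :\ T) _ (tilingW (subxx _) (subD1set _ _) tP).
  by move: ltn; rewrite (cardsD1 T P) TP.
have [tT _] := tP.1 T TP; have := tT; case/and3P => /eqP c1 /eqP c2 c12.
have [||Q2 [tQ2 cQ2]] := harvest (n := th) s0 c12; rewrite ?c1 ?c2 ?mulnA //.
have TC : supp T = cover [set T] by rewrite /cover big_set1.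
have TP1 : [set T] \subset P by rewrite sub1set.
have dj := cover_disjoint tP TP1; rewrite -TC in dj.
have [tU cU] := tilingU s0 dj tQ1 tQ2.
exists (Q1 :|: Q2); split; last by rewrite cU cQ1 cQ2 (cardsD1 T P) TP; lia.
apply: tilingW tU => //; apply/subUsetP; split; first by apply: cover_sub; apply: subD1set.
exact: bigcup_sup.
Qed.

Lemma round s th K U P i :
  0 < s -> 0 < th -> 0 < K -> 4 * K * a <= th * c -> th * a + b <= th * b ->
  tiling (th * s) U P ->
  (forall v, v \in U -> (a * K + c) * #|U| <= #|nbrs v U| * (c * K)) ->
  16 * K * (2 * i * (th * s * c)) + 16 * K * leftover_bound s th K <= #|U| ->
  leftover_bound s th K + i * (th * s * c) <= #|U :\: cover P| ->
  exists Q, tiling s U Q /\ #|Q| = th * #|P| + i.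
Proof.
move=> s0 th0 K0 hth hab tP degU bigU bigL.
have [P' [L' [Q [P'P L'L cL tQ [cQ cP]]]]] := improve_iter s0 th0 K0 hth hab tP degU bigU bigL.
have [Q' [tQ' cQ']] := split_tiling s0 (tilingW (subxx _) P'P tP).
have dj : [disjoint cover (P :\: P') :|: ((U :\: cover P) :\: L') & cover P'].
  rewrite -setI_eq0 setIUl setU_eq0 !setI_eq0 (cover_disjoint tP P'P) /=.
  apply: disjointWl (subsetDl _ _) _; apply: disjointWr (cover_sub P'P) _.
  by rewrite -setI_eq0 setIC setIDA setIC setDIl setDv setI0.
have [tU cU] := tilingU s0 dj tQ tQ'.
exists (Q :|: Q'); split; last by rewrite cU cQ' cQ.
have PU := cover_subset tP.
apply: tilingW tU => //; apply/subUsetP; split; first apply/subUsetP; first split.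
- by apply: subset_trans PU; apply: cover_sub; apply: subsetDl.
- by apply: subset_trans (subsetDl _ _) (subsetDl _ _).
- by apply: subset_trans PU; apply: cover_sub.
Qed.

Definition round_bound s th K :=
  (32 * K + 2 * c.+1) * leftover_bound s th K + 128 * K * (th * s * c) * c.+1.

(** Exchanging while the uncovered set is large gains a constant proportion of
    the vertices, and that proportion does not depend on the scale s. *)
Lemma tiling_round s th K U P :
  0 < s -> 0 < th -> 0 < K -> 4 * K * a <= th * c -> th * a + b <= th * b ->
  tiling (th * s) U P ->
  (forall v, v \in U -> (a * K + c) * #|U| <= #|nbrs v U| * (c * K)) ->
  round_bound s th K <= #|U| -> #|P| * (th * s) * c.+1 < #|U| ->
  exists Q, tiling s U Q /\
    #|P| * (th * s) * (128 * K * th * c * c.+1) + #|U| <= #|Q| * s * (128 * K * th * c * c.+1).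
Proof.
move=> s0 th0 K0 hth hab tP degU; rewrite /round_bound; set lb := leftover_bound s th K.
set t := th * s * c => bigU hP.
have c0 : 0 < c by rewrite /c; lia.
have t0 : 0 < t by rewrite !muln_gt0 th0 s0 c0.
pose d := 64 * K * t * c.+1; pose i := #|U| %/ d.
have d0 : 0 < d by rewrite !muln_gt0 K0 th0 s0 c0.
have id_le : i * d <= #|U| by apply: leq_trunc_div.
have id_ge : #|U| <= i * d + d.
  by rewrite {1}(divn_eq #|U| d) leq_add2l ltnW // ltn_mod.
have cL : #|U :\: cover P| = #|U| - #|P| * t.
  by rewrite cardsDS ?(card_cover_tiling tP) //; apply: cover_subset tP.
have dE : i * d = 64 * K * (i * t) + 64 * K * (i * t) * c by rewrite /d; lia.
have it_le : i * t <= K * (i * t) by rewrite leq_pmull.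
have [||Q [tQ cQ]] := round s0 th0 K0 hth hab tP degU (i := i).
- by rewrite -/t -/lb; lia.
- rewrite -/t -/lb cL -(leq_pmul2r (ltn0Sn c)) mulnBl.
  have -> : #|P| * t * c.+1 = c * (#|P| * (th * s) * c.+1) by rewrite /t; lia.
  have : c * (#|P| * (th * s) * c.+1) <= c * #|U| by rewrite leq_mul2l ltnW ?orbT.
  have : (i * t) * c <= K * (i * t) * c by rewrite leq_mul2r it_le orbT.
  by lia.
exists Q; split=> //; rewrite cQ.
have : #|U| <= 2 * (i * d) by rewrite /d in id_ge *; lia.
by rewrite /d /t; lia.
Qed.

(** Each round divides the scale by th and gains a fixed proportion of U, so at
    most 128 * K * th * c * c.+1 rounds can fail to reach the conclusion. *)
Lemma tiling_rounds th K U j :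
  let J := 128 * K * th * c * c.+1 in
  0 < th -> 0 < K -> 4 * K * a <= th * c -> th * a + b <= th * b ->
  (forall v, v \in U -> (a * K + c) * #|U| <= #|nbrs v U| * (c * K)) ->
  (forall i, i < J -> round_bound (th ^ i) th K <= #|U|) -> j <= J ->
  forall P, tiling (th ^ j) U P -> #|U| * (J - j) <= #|P| * th ^ j * J ->
  exists Q, tiling 1 U Q /\ #|U| <= #|Q| * c.+1.
Proof.
move=> J th0 K0 hth hab degU bigU.
have J0 : 0 < J by rewrite !muln_gt0 K0 th0 /c; lia.
elim: j => [|j IH] jJ P tP hP.
  exists P; split; first by rewrite expn0 in tP.
  move: hP; rewrite expn0 subn0 muln1 leq_pmul2r // => hP.
  by apply: leq_trans hP _; rewrite leq_pmulr.
(* If the tiles already cover enough, cutting them into tiles of scale 1 ends. *)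
case: (leqP #|U| (#|P| * th ^ j.+1 * c.+1)) => hU.
  rewrite -(muln1 (th ^ _)) in tP.
  have [Q [tQ cQ]] := split_tiling (ltn0Sn 0) tP.
  exists Q; split; last by rewrite cQ (mulnC (th ^ _)).
  by apply: tilingW tQ => //; apply: cover_subset tP.
rewrite expnS in tP hU hP.
have s0 : 0 < th ^ j by rewrite expn_gt0 th0.
have [Q [tQ hQ]] := tiling_round s0 th0 K0 hth hab tP degU (bigU j jJ) hU.
apply: (IH (ltnW jJ) Q tQ); apply: leq_trans hQ.
apply: leq_trans (leq_add hP (leqnn #|U|)).
by rewrite -mulnSr; rewrite leq_mul2l; lia.
Qed.

Definition tiling_bound K := let th := 4 * K * a + b in
  \max_(i < 128 * K * th * c * c.+1) round_bound (th ^ i) th K.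

(** The rounds start from the empty tiling at scale th ^ (128 * K * th * c * c.+1)
    and divide the scale by th each time.  The degree surplus 1 / K fixes th, and
    nothing depends on U except through the lower bound on its size. *)
Theorem almost_tiling K U : 0 < K -> a < b -> tiling_bound K <= #|U| ->
  (forall v, v \in U -> (a * K + c) * #|U| <= #|nbrs v U| * (c * K)) ->
  exists Q, tiling 1 U Q /\ #|U| <= #|Q| * c.+1.
Proof.
move=> K0 ab bigU degU; set th := 4 * K * a + b.
have hth : 4 * K * a <= th * c.
  by apply: leq_trans (leq_pmulr _ _); [rewrite /th leq_addr|rewrite /c; lia].
have hab : th * a + b <= th * b.
  apply: (@leq_trans (th * a.+1)); last by rewrite leq_mul2l ab orbT.
  by rewrite mulnSr leq_add2l /th leq_addl.
apply: (@tiling_rounds th K U (128 * K * th * c * c.+1)) (tiling0 _ _) _ => //.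
- by rewrite /th; lia.
- move=> i iJ; apply: leq_trans bigU; rewrite /tiling_bound -/th.
  exact: (leq_bigmax (Ordinal iJ)).
- by rewrite subnn muln0.
Qed.

End Tiling.

(** * Tile words and elimination orders *)

Section Words.
Local Open Scope nat_scope.
Variables (V : finType) (e : rel V) (k : nat).
Hypothesis e_sym : symmetric e.
Hypothesis k_ge3 : 3 <= k.
Implicit Types (x y z : V) (s w u v acc : seq V).

(** The last vertex read has two neighbours among its k predecessors; acc lists
    the vertices read so far, latest first. *)
Definition spare_end acc :=
  if acc is z :: acc' then 2 <= count (e z) (take k acc') else false.

(** When this holds, y is in fewer than k missing pairs with its k predecessors,
    or it may be swapped with the vertex just before it, see [elimination]. *)
Definition pred_ok acc y :=
  [|| size acc < k, has (e y) (take k acc) | spare_end acc].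

Fixpoint scan acc w :=
  if w is y :: w' then pred_ok acc y && scan (y :: acc) w' else true.

Lemma scan_cat acc u v : scan acc (u ++ v) = scan acc u && scan (catrev u acc) v.
Proof. by elim: u acc => //= y u IH acc; rewrite IH andbA. Qed.

Lemma scan_short acc w : size acc + size w <= k -> scan acc w.
Proof.
elim: w acc => //= y w IH acc h; rewrite /pred_ok IH ?andbT; last by rewrite /=; lia.
by rewrite (_ : size acc < k) //; lia.
Qed.

(** x stays among the last k letters while the run w is read. *)
Lemma scan_run x mid acc w : all (e x) w -> size mid + size w <= k ->
  scan (mid ++ x :: acc) w.
Proof.
elim: w mid => //= y w IH mid /andP [exy hw] h.
rewrite -cat_cons IH ?andbT //=; last by lia.
rewrite /pred_ok (_ : has _ _) ?orbT //; apply/hasP; exists x; last by rewrite e_sym.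
have lt : size mid < k by lia.
rewrite take_cat ltnNge ltnW //= mem_cat.
by case: (k - size mid) (subn_gt0 (size mid) k) => [|m]; rewrite ?lt // inE eqxx orbT.
Qed.

Lemma all_sub (P : pred V) u v : {subset u <= v} -> all P v -> all P u.
Proof. by move=> sub /allP h; apply/allP => x /sub; apply: h. Qed.

Definition complete u v := all (fun x => all (e x) v) u.

Fixpoint left_word As Bs : seq V :=
  if As is x :: As' then x :: take k Bs ++ left_word As' (drop k Bs) else [::].

Definition right_word Ak b0 X a0 b1 a1 b2 : seq V :=
  Ak ++ b0 :: X ++ [:: a0; b1; a1; b2].

Lemma complete_sym u v : complete u v -> complete v u.
Proof.
move=> /allP h; apply/allP => y yv; apply/allP => x xu; rewrite e_sym.
by have /allP := h x xu; apply.
Qed.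

Lemma size_left_word As Bs : size Bs = k * size As ->
  size (left_word As Bs) = k.+1 * size As.
Proof.
elim: As Bs => [|x As IH] Bs /= sB; first by rewrite muln0.
rewrite size_cat size_takel ?IH ?size_drop; lia.
Qed.

Lemma perm_left_word As Bs : size Bs = k * size As ->
  perm_eq (left_word As Bs) (As ++ Bs).
Proof.
elim: As Bs => [|x As IH] Bs /= sB; first by rewrite muln0 in sB; rewrite (size0nil sB).
rewrite perm_cons -[in X in perm_eq _ X](cat_take_drop k Bs) perm_sym perm_catCA.
rewrite perm_cat2l perm_sym; apply: IH.
by rewrite size_drop; lia.
Qed.

Lemma scan_left_word As Bs acc : complete As Bs -> size Bs = k * size As ->
  spare_end acc \/ (exists z acc', acc = z :: acc' /\ all (e z) As) ->
  scan acc (left_word As Bs).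
Proof.
elim: As Bs acc => [|x As IH] Bs acc //= /andP [xB cAB] sB hacc.
have st : size (take k Bs) = k by rewrite size_takel //; lia.
apply/andP; split.
  rewrite /pred_ok; case: hacc => [-> //|[z [acc' [-> /= /andP [exz _]]]]]; first by rewrite !orbT.
  by case: k k_ge3 => //= k' _; rewrite e_sym exz !orbT.
rewrite scan_cat; apply/andP; split.
  apply: (@scan_run x [::]); last by rewrite st.
  by apply: all_sub xB => y /mem_take.
apply: IH.
- by apply: sub_all cAB => y; apply: all_sub => z /mem_drop.
- by rewrite size_drop; lia.
right; case/lastP: (take k Bs) st (@mem_take k V Bs) => [|t z _ sub]; first by move=> /= k0; lia.
exists z, (catrev t (x :: acc)); split; first by rewrite -cats1 catrev_catl.
have zB : z \in Bs by apply: sub; rewrite mem_rcons inE eqxx.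
by apply/allP => y yA; rewrite e_sym; have /allP /(_ y yA) /allP := cAB; apply.
Qed.

Lemma spare_end_right_word acc Ak b0 X a0 b1 a1 b2 :
  complete (Ak ++ [:: a0; a1]) [:: b0; b1; b2] ->
  spare_end (catrev (right_word Ak b0 X a0 b1 a1 b2) acc).
Proof.
move=> /complete_sym /= /and4P [_ _ h2 _]; rewrite /right_word.
move: h2; rewrite all_cat /= => /and3P [_ e20 /andP [e21 _]].
have [k' kE] : exists k', k = k'.+3 by exists (k - 3); lia.
rewrite catrev_catl /= catrev_catl /= kE /= e21 /= addnCA.
by rewrite /= e20; lia.
Qed.

(** Every letter follows a neighbour at distance 1 or 2, except those of Ak,
    which see the letter before Ak or the beginning, and the letter of X, which
    follows b0 and the k neighbours of b0 in Ak. *)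
Lemma scan_right_word acc Ak b0 X a0 b1 a1 b2 :
  size Ak = k -> size X <= 1 -> complete (Ak ++ [:: a0; a1]) [:: b0; b1; b2] ->
  acc = [::] \/ (exists z acc', acc = z :: acc' /\ all (e z) Ak) ->
  scan acc (right_word Ak b0 X a0 b1 a1 b2).
Proof.
move=> sA sX /complete_sym /= /and4P [h0 h1 h2 _] hacc; rewrite /right_word.
move: h0 h1 h2; rewrite !all_cat /=.
move=> /and3P [h0 e00 /andP [e01 _]] /and3P [h1 e10 /andP [e11 _]] /and3P [h2 e20 /andP [e21 _]].
have [k' kE] : exists k', k = k'.+3 by exists (k - 3); lia.
rewrite scan_cat; apply/andP; split.
  case: hacc => [->|[z [acc' [-> hz]]]]; first by apply: scan_short; rewrite sA.
  by apply: (@scan_run z [::]); rewrite ?sA.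
have takeA : take k (catrev Ak acc) = rev Ak.
  by rewrite catrevE take_cat size_rev sA ltnn subnn take0 cats0.
have hasA : has (e b0) (rev Ak).
  rewrite has_rev -[has _ _]negbK -all_predC; apply/negP => /allP hn.
  case: Ak sA h0 hn {takeA hacc h1 h2} => [|y Ak'] /= sA; first by lia.
  by move=> /andP [ey _] /(_ y); rewrite inE eqxx /= ey => /(_ isT).
rewrite /=; apply/andP; split; first by rewrite /pred_ok takeA hasA !orbT.
rewrite scan_cat; apply/andP; split.
  case: X sX => [|x [|//]] //= _; rewrite /pred_ok /spare_end /= takeA count_rev.
  rewrite (_ : count _ _ = size Ak) ?sA ?(ltnW k_ge3) ?orbT //.
  by apply/eqP; rewrite -sA -all_count.
have h z1 z2 acc' : e z1 z2 -> pred_ok (z2 :: acc') z1.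
  by move=> e12; rewrite /pred_ok kE /= e12 orbT.
have hX : pred_ok (catrev X (b0 :: catrev Ak acc)) a0.
  case: X sX => [|x [|//]] //= _; first by apply: h; rewrite e_sym.
  by rewrite /pred_ok kE /= (e_sym a0 b0) e00 !orbT.
by rewrite /= hX !h // e_sym.
Qed.

(** All that is used about a tile word, given by its two parts on either side of
    the cut. *)
Record cut_tile q (t : seq V * seq V) : Prop := CutTile {
  tile_scan1 : forall acc, spare_end acc -> scan acc t.1;
  tile_scan2 : forall acc, scan (catrev t.1 acc) t.2;
  tile_scan0 : scan [::] t.2;
  tile_spare_end : forall acc, spare_end (catrev t.2 acc);
  tile_cut : complete (drop (size t.1 - k) t.1) (take k t.2);
  tile_size1 : k <= size t.1 <= k.+1 * q;
  tile_size2 : k <= size t.2 <= k + 6 }.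

(** The left part ends with k letters of the large side, so that the cut is
    crossed at distance at most k only by edges between the two sides. *)
Lemma left_word_tail As Bs : As != [::] -> size Bs = k * size As ->
  {subset drop (size (left_word As Bs) - k) (left_word As Bs) <= Bs}.
Proof.
elim: As Bs => [|x As IH] Bs //= _ sB z.
have st : size (take k Bs) = k by rewrite size_takel //; lia.
have sd : size (drop k Bs) = k * size As by rewrite size_drop sB mulnS addKn.
case: As IH sB sd => [|y As] IH sB sd.
  by rewrite /= cats0 st subSnn /= drop0 => /mem_take.
rewrite size_cat st; set w := left_word _ _ in IH *.
have sw : size w = k.+1 * (size As).+1 by rewrite size_left_word.
have kw : k <= size w by rewrite sw (leq_trans (leqnSn k)) // leq_pmulr.
have -> : (k + size w).+1 - k = (k + (size w - k)).+1.
  by rewrite subnKC // -addnS addKn.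
rewrite /= drop_cat st ltnNge leq_addr /= addKn => zw.
by apply: (@mem_drop k); apply: IH zw.
Qed.

Lemma cut_tile_exists q As Bs X : 0 < q -> complete As Bs ->
  size As = q + k + 2 -> size Bs = k * q + 3 -> size X <= 1 ->
  exists t, cut_tile q t /\ perm_eq (t.1 ++ t.2) (As ++ Bs ++ X).
Proof.
move=> q0 cAB sA sB sX.
have [A1 [Ak [a0 [a1 [eA sA1 sAk]]]]] : exists A1 Ak a0 a1,
    [/\ As = A1 ++ Ak ++ [:: a0; a1], size A1 = q & size Ak = k].
  exists (take q As), (take k (drop q As)).
  have : size (drop k (drop q As)) = 2 by rewrite !size_drop; lia.
  case E: (drop k (drop q As)) => [|a0 [|a1 [|]]] //= _; exists a0, a1; split.
  - by rewrite -E !cat_take_drop.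
  - by rewrite size_takel //; lia.
  - by rewrite size_takel // size_drop; lia.
have [B1 [b0 [b1 [b2 [eB sB1]]]]] : exists B1 b0 b1 b2,
    Bs = B1 ++ [:: b0; b1; b2] /\ size B1 = k * q.
  exists (take (k * q) Bs).
  have : size (drop (k * q) Bs) = 3 by rewrite size_drop; lia.
  case E: (drop (k * q) Bs) => [|b0 [|b1 [|b2 [|]]]] //= _; exists b0, b1, b2; split.
  - by rewrite -E cat_take_drop.
  - by rewrite size_takel //; lia.
have cS u v : {subset u <= As} -> {subset v <= Bs} -> complete u v.
  by move=> su sv; apply: all_sub su _; apply: sub_all cAB => x; apply: all_sub.
have sB1' : size B1 = k * size A1 by rewrite sA1.
have A1n : A1 != [::] by rewrite -size_eq0 sA1; lia.
have sub1 : {subset A1 <= As} by move=> x xA; rewrite eA mem_cat xA.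
have subk : {subset Ak <= As} by move=> x xA; rewrite eA !mem_cat xA orbT.
have subB1 : {subset B1 <= Bs} by move=> x xB; rewrite eB mem_cat xB.
have tailB : {subset drop (size (left_word A1 B1) - k) (left_word A1 B1) <= Bs}.
  by move=> x /(left_word_tail A1n sB1') /subB1.
have sl := size_left_word sB1'; rewrite sA1 in sl.
have kq : k <= k.+1 * q by rewrite (leq_trans (leqnSn k)) // leq_pmulr.
have cR : complete (Ak ++ [:: a0; a1]) [:: b0; b1; b2].
  apply: cS => x; first by rewrite eA [in X in _ -> X]mem_cat => ->; rewrite orbT.
  by rewrite eB [in X in _ -> X]mem_cat => ->; rewrite orbT.
exists (left_word A1 B1, right_word Ak b0 X a0 b1 a1 b2); split; last first.
  apply/permP => P /=; rewrite /right_word !count_cat.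
  have /permP/(_ P) := perm_left_word sB1'; rewrite count_cat eA eB !count_cat /= !count_cat /=.
  by lia.
split=> /=.
- by move=> acc gacc; apply: scan_left_word => //; [exact: cS|left].
- move=> acc; apply: (scan_right_word sAk sX cR); right.
  case/lastP E: (left_word A1 B1) => [|w z]; first by rewrite E /= in sl; lia.
  exists z, (catrev w acc); split; first by rewrite -cats1 catrev_catl.
  have zB : z \in Bs.
    apply: tailB; rewrite E size_rcons -cats1 drop_cat.
    case: ltnP => [_|]; first by rewrite mem_cat inE eqxx orbT.
    move=> lt; rewrite (_ : _ - _ = 0); last by lia.
    by rewrite inE.
  apply/allP => y yA; rewrite e_sym.
  by have /allP /(_ y (subk y yA)) /allP := cAB; apply.
- by apply: (scan_right_word sAk sX cR); left.
- by move=> acc; apply: spare_end_right_word.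
- apply: complete_sym; apply: cS => // x.
  by rewrite /right_word take_cat sAk ltnn subnn take0 cats0 => /subk.
- by rewrite sl kq leqnn.
- by rewrite /right_word size_cat sAk /= size_cat /=; lia.
Qed.

Lemma scan_pred_ok s y : scan [::] s -> y \in s -> pred_ok (rev (take (index y s) s)) y.
Proof.
move=> + ys; rewrite -index_mem in ys.
rewrite -{1}(cat_take_drop (index y s) s) (drop_nth y ys) nth_index; last by rewrite -index_mem.
by rewrite scan_cat /= catrevE cats0 => /and3P [].
Qed.

Section Elimination.
Variables (s : seq V) (F : rel V).
Hypothesis s_uniq : uniq s.
Hypothesis s_all : forall x, x \in s.
Hypothesis s_scan : scan [::] s.
Hypothesis F_near : forall x y, F x y -> index y s <= index x s + k.
Hypothesis F_ne : forall x y, F x y -> x != y /\ ~~ e x y.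

Let pos x := index x s.
Let before y := rev (take (pos y) s).
Let bd y := #|[set x | (pos x < pos y) && F x y]|.

Lemma F_before x y : F x y -> pos x < pos y -> x \in take k (before y).
Proof.
move=> Fxy lt; have near := F_near Fxy.
have py : pos y <= size s by apply: index_size.
rewrite /before take_rev mem_rev size_takel //.
have <- : nth x (drop (pos y - k) (take (pos y) s)) (pos x - (pos y - k)) = x.
  rewrite nth_drop nth_take; rewrite ?subnKC ?nth_index //; rewrite /pos in near lt *; lia.
apply: mem_nth; rewrite size_drop size_takel //; rewrite /pos in near lt py *; lia.
Qed.

Lemma bd_count y : bd y <= count (fun x => ~~ e y x) (take k (before y)).
Proof.
rewrite -size_filter; apply: leq_trans (card_size _); apply: subset_leq_card.
apply/subsetP => x; rewrite inE => /andP [lt Fxy].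
by rewrite mem_filter F_before // e_sym; have [_ ->] := F_ne Fxy.
Qed.

Lemma bd_count_adj y m : m <= count (e y) (take k (before y)) -> bd y <= k - m.
Proof.
move=> h; apply: leq_trans (bd_count y) _.
have : count (e y) (take k (before y)) + count (fun x => ~~ e y x) (take k (before y)) <= k.
  by rewrite (count_predC (e y)) size_take_min geq_minl.
by lia.
Qed.

(** The predecessors that are neighbours of y do not count in [bd y]. *)
Lemma bd_dichotomy y : bd y < k \/
  exists z, [/\ pos y = (pos z).+1 & bd z <= k - 2].
Proof.
have := scan_pred_ok s_scan (s_all y); rewrite -/(pos y) -/(before y) => /or3P [lt|h|g].
- left; apply: leq_ltn_trans (bd_count y) _; apply: leq_ltn_trans (count_size _ _) _.
  by rewrite size_take_min (leq_ltn_trans (geq_minr _ _)).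
- left; have : bd y <= k - 1 by apply: bd_count_adj; rewrite -has_count.
  by lia.
right; move: g; rewrite /before; case E: (pos y) => [|i]; first by rewrite take0.
have ls : i < size s by rewrite -E -[_ <= _]/(_ < (size s).+1) ltnS index_size.
rewrite (take_nth y ls) rev_rcons /= => g.
exists (nth y s i); have pz : pos (nth y s i) = i by rewrite /pos index_uniq.
by rewrite pz; split=> //; apply: bd_count_adj; rewrite /before pz.
Qed.

Let bad y := k <= bd y.
Let o y := if bad y then (pos y).*2 - 3 else (pos y).*2.

Lemma pos_inj : injective pos.
Proof. by move=> x y e0; rewrite -(nth_index x (s_all x)) -/(pos x) e0 nth_index. Qed.

Lemma bad_pos y : bad y -> 2 < pos y.
Proof.
move=> b; apply: leq_trans k_ge3 _; apply: leq_trans b _.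
apply: leq_trans (bd_count y) _; apply: leq_trans (count_size _ _) _.
by rewrite size_take_min (leq_trans (geq_minr _ _)) // size_rev size_takel // index_size.
Qed.

(** A vertex with k earlier missing pairs is moved just in front of its immediate
    predecessor z.  It loses the pair with z, and z, having two neighbours among
    its own predecessors, can afford to gain it. *)
Lemma elimination : exists o : V -> nat, injective o /\
  forall y, #|[set x | (o x < o y) && F x y]| <= k - 1.
Proof.
exists o; split.
  have sep (b1 b2 : bool) (i j : nat) : (b1 -> 2 < i) -> (b2 -> 2 < j) ->
      (if b1 then i.*2 - 3 else i.*2) = (if b2 then j.*2 - 3 else j.*2) -> i = j.
    case: b1; case: b2 => h1 h2; try (have := h1 isT); try (have := h2 isT);
    clear; lia.
  move=> x y e0; apply: pos_inj; exact: sep (@bad_pos x) (@bad_pos y) e0.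
move=> y; case b_y: (bad y).
  have [lt|[z [pz bz]]] := bd_dichotomy y; first by move: b_y; rewrite /bad leqNgt lt.
  have zlast : exists acc', before y = z :: acc'.
    rewrite /before pz; have ls : pos z < size s by rewrite index_mem.
    by rewrite (take_nth z ls) rev_rcons nth_index //; exists (rev (take (pos z) s)).
  have [acc' bE] := zlast.
  have bz' : bad z = false by apply/negbTE; rewrite /bad -ltnNge; lia.
  have sub : [set x | (o x < o y) && F x y] \subset [set x in take k.-1 acc'].
    apply/subsetP => x; rewrite !inE => /andP [lt Fxy].
    have p2 := bad_pos b_y.
    have [px xz] : pos x < pos y /\ x != z.
      move: lt; rewrite /o b_y; case bx: (bad x); last first.
        move=> lt; have lt' : pos x < pos z by lia.
        by split; [lia|apply: contraTneq lt' => ->; rewrite ltnn].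
      have := bad_pos bx; move=> px lt; split; first by lia.
      by apply: contraFneq bz' => <-.
    have := F_before Fxy px; rewrite bE.
    by case: k k_ge3 => //= k' _; rewrite inE (negbTE xz).
  apply: leq_trans (subset_leq_card sub) _; rewrite cardsE; apply: leq_trans (card_size _) _.
  by rewrite size_take_min -subn1 geq_minl.
(* The only vertex that can newly precede y is a bad one just after it. *)
case: (pickP (fun x => bad x && (pos x == (pos y).+1) && F x y)) => [x|hno].
  move=> /andP [/andP [bx /eqP px] Fxy].
  have [lt|[z [pz bz]]] := bd_dichotomy x; first by move: bx; rewrite /bad leqNgt lt.
  have zy : z = y by apply: pos_inj; lia.
  rewrite zy in bz.
  apply: (@leq_trans (1 + bd y)); last by lia.
  rewrite -(cards1 x); apply: leq_trans (leq_card_setU _ _); apply: subset_leq_card.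
  apply/subsetP => w; rewrite !inE => /andP [lt Fwy]; rewrite Fwy andbT.
  move: lt; rewrite /o b_y; have [/eqP nw _] := F_ne Fwy; have np : pos w <> pos y.
    by move/pos_inj.
  case bw: (bad w) => lt; last by apply/orP; right; lia.
  case: (ltngtP (pos w) (pos y)) => [h|h|/np //]; rewrite ?orbT // orbF.
  rewrite -(inj_eq pos_inj) px eqn_leq; have := bad_pos bw; move: lt h; clear; lia.
apply: (@leq_trans (bd y)); last by move: b_y; rewrite /bad; lia.
apply: subset_leq_card; apply/subsetP => w; rewrite !inE => /andP [lt Fwy]; rewrite Fwy andbT.
move: lt; rewrite /o b_y; have [/eqP nw _] := F_ne Fwy; have np : pos w <> pos y.
  by move/pos_inj.
case bw: (bad w) => lt; last by lia.
have := hno w; rewrite bw Fwy andbT /=; have := bad_pos bw; lia.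
Qed.

End Elimination.

End Words.

(** * The cyclic order built from tile words *)

Section Near.
Local Open Scope nat_scope.
Variables (T : eqType) (k : nat) (P : rel T).
Implicit Types u v s : seq T.

Fixpoint near_all s := if s is x :: s' then all (P x) (take k s') && near_all s' else true.

Lemma near_all_cat u v : near_all u -> near_all v ->
  (forall x y, x \in drop (size u - k) u -> y \in take k v -> P x y) -> near_all (u ++ v).
Proof.
elim: u => //= x u IH /andP [hx hu] hv h; rewrite IH ?andbT //; last first.
  move=> z y zu; apply: h; case: (leqP k (size u)) => hk.
    by rewrite subSn // /=.
  have e0 : size u - k = 0 by lia.
  have e1 : (size u).+1 - k = 0 by lia.
  by rewrite e1 drop0 inE; rewrite e0 drop0 in zu; rewrite zu orbT.
rewrite take_cat; case: ltnP => // hk.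
rewrite all_cat take_oversize // in hx *; rewrite hx /=; apply/allP => y yv; apply: h.
  case: (ltnP (size u) k) => hk2.
    by rewrite (_ : _ - _ = 0) ?drop0 ?mem_head //; lia.
  have e0 : k = size u by lia.
  by move: yv; rewrite e0 subnn take0.
have -> : take k v = take (k - size u) v ++ take (size u) (drop (k - size u) v).
  by rewrite -takeD subnK.
by rewrite mem_cat yv.
Qed.

Lemma near_all_nth x0 s i j : near_all s -> i < j -> j < size s -> j <= i + k ->
  P (nth x0 s i) (nth x0 s j).
Proof.
elim: s i j => //= x s IH [|i] [|j] //= /andP [hx hs] ij js near; last exact: IH.
have /allP := hx; apply; have <- : nth x0 (take k s) j = nth x0 s j by rewrite nth_take.
by apply: mem_nth; rewrite size_take_min leq_min; apply/andP; split.
Qed.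

Lemma near_all_sub s : {in s &, forall x y, P x y} -> near_all s.
Proof.
elim: s => //= x s IH h; apply/andP; split; last first.
  by apply: IH => y z ys zs; apply: h; rewrite inE ?ys ?zs orbT.
by apply/allP => y /mem_take ys; apply: h; rewrite inE ?eqxx ?ys ?orbT.
Qed.

End Near.

Section Segments.
Local Open Scope nat_scope.
Variables (V : finType) (k q : nat).
Implicit Types (l r : seq V) (ts : seq (seq V * seq V)).

(** The cyclic sequence of tile words, cut inside the tiles instead of between
    them: r and l are the right and left parts of the tile at the cut where the
    cycle is opened. *)
Fixpoint segs r ts l : seq (seq V) :=
  if ts is t :: ts' then (r ++ t.1) :: segs t.2 ts' l else [:: r ++ l].

Definition tile_words ts := flatten [seq t.1 ++ t.2 | t <- ts].

Lemma flatten_segs r ts l : flatten (segs r ts l) = r ++ tile_words ts ++ l.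
Proof.
elim: ts r => [|t ts IH] r /=; first by rewrite cats0.
by rewrite IH /tile_words /= -!catA.
Qed.

Definition seg_index (ss : seq (seq V)) x := find (fun w : seq V => x \in w) ss.

Lemma seg_index_same ss w x y : uniq (flatten ss) -> w \in ss -> x \in w -> y \in w ->
  seg_index ss x = seg_index ss y.
Proof.
rewrite /seg_index; elim: ss => //= w0 ss IH; rewrite cat_uniq => /and3P [_ dj uss].
rewrite inE => /orP [/eqP -> -> -> //|wss] xw yw.
have nin z : z \in w -> z \in w0 = false.
  move=> zw; apply/negbTE/negP => zw0; case/hasP: dj; exists z => //.
  by apply/flattenP; exists w.
by rewrite !nin // (IH uss wss xw yw).
Qed.

Lemma seg_index_mem ss x : x \in flatten ss -> x \in nth [::] ss (seg_index ss x).
Proof.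
by move=> /flattenP [w wss xw]; apply: (@nth_find _ [::] (fun w : seq V => x \in w)); apply/hasP; exists w.
Qed.

Lemma card_seg_index ss m (l : nat) : (forall x, x \in flatten ss) ->
  (forall w, w \in ss -> size w <= m) -> #|[set x | seg_index ss x == l]| <= m.
Proof.
move=> hall hm; apply: (@leq_trans #|nth [::] ss l|).
  apply: subset_leq_card; apply/subsetP => x; rewrite inE => /eqP <-.
  exact: seg_index_mem.
apply: leq_trans (card_size _) _; case: (ltnP l (size ss)) => hl; first by apply: hm; apply: mem_nth.
by rewrite nth_default.
Qed.

Variables (e : rel V).

(** Two letters at distance at most k in different segments are separated by a
    cut, hence adjacent; segments have length at least k, so that only one cut
    lies between them. *)
Lemma near_segs (P : rel V) r ts l :
  k <= size l -> (forall t, t \in ts -> cut_tile e k q t) ->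
  (forall w, w \in segs r ts l -> {in w &, forall x y, P x y}) ->
  (forall x y, e x y -> P x y) ->
  near_all k P (flatten (segs r ts l)).
Proof.
move=> sl + + eP; elim: ts r => [|t ts IH] r htl hw /=.
  by rewrite cats0; apply: near_all_sub; apply: hw; rewrite mem_head.
have ct : cut_tile e k q t by apply: htl; rewrite mem_head.
case/andP: (tile_size1 ct) => s1 _; case/andP: (tile_size2 ct) => s2 _.
apply: near_all_cat.
- by apply: near_all_sub; apply: hw; rewrite mem_head.
- by apply: IH => [t' t'ts|w wss]; [apply: htl|apply: hw]; rewrite inE ?t'ts ?wss orbT.
move=> x y; rewrite size_cat drop_cat ltnNge -addnBA // leq_addr /= addKn => xd.
rewrite flatten_segs takel_cat // => yt; apply: eP.
by have /allP /(_ x xd) /allP := tile_cut ct; apply.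
Qed.

Lemma scan_tiles acc ts l : spare_end e k acc -> (forall t, t \in ts -> cut_tile e k q t) ->
  (forall acc, spare_end e k acc -> scan e k acc l) -> scan e k acc (tile_words ts ++ l).
Proof.
move=> + + hl; elim: ts acc => [|t ts IH] acc ga ht; first exact: hl.
have ct : cut_tile e k q t by apply: ht; rewrite mem_head.
rewrite /tile_words /= -!catA scan_cat (tile_scan1 ct) //= scan_cat (tile_scan2 ct) /=.
apply: IH; first exact: (tile_spare_end ct).
by move=> t' t'ts; apply: ht; rewrite inE t'ts orbT.
Qed.

Lemma size_segs r ts l w : size r <= k + 6 -> size l <= k.+1 * q ->
  (forall t, t \in ts -> cut_tile e k q t) -> w \in segs r ts l ->
  size w <= k.+1 * q + k + 6.
Proof.
move=> + sl; elim: ts r => [|t ts IH] r sr ht /=.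
  by rewrite inE => /eqP ->; rewrite size_cat; lia.
have ct : cut_tile e k q t by apply: ht; rewrite mem_head.
case/andP: (tile_size1 ct) => _ s1; case/andP: (tile_size2 ct) => _ s2.
rewrite inE => /orP [/eqP ->|]; first by rewrite size_cat; lia.
by apply: IH => // t' t'ts; apply: ht; rewrite inE t'ts orbT.
Qed.

End Segments.

Section CyclicOrder.
Local Open Scope nat_scope.
Variables (V : finType) (G : sgraph V) (k q : nat).
Hypothesis k_ge3 : 3 <= k.

Lemma ham_cycle_power_of_seq (H : sgraph V) (s : seq V) :
  uniq s -> (forall x, x \in s) -> k <= size s ->
  (forall x0 i j, i < j -> j < size s -> j <= i + k -> adj H (nth x0 s i) (nth x0 s j)) ->
  (forall x y, x \in drop (size s - k) s -> y \in take k s -> adj H x y) ->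
  has_ham_cycle_power k H.
Proof.
move=> us hall ks hn hw.
have sV : size s = #|V| by rewrite -(card_uniqP us); apply: eq_card => x; rewrite hall.
have V0 : 0 < #|V| by lia.
have [x0 _] : exists x0 : V, x0 \in V by apply/card_gt0P.
have key (i j : 'I_#|V|) : i < j -> cyclic_dist i j <= k -> adj H (nth x0 s i) (nth x0 s j).
  move=> ij; rewrite /cyclic_dist geq_min; have jV := ltn_ord j; have iV := ltn_ord i.
  have -> : (i + (#|V| - j)) %% #|V| = i + (#|V| - j) by rewrite modn_small //; lia.
  have -> : (j + (#|V| - i)) %% #|V| = j - i.
    rewrite (_ : j + (#|V| - i) = (j - i) + #|V|); last by lia.
    by rewrite modnDr modn_small //; lia.
  case/orP => near.
    rewrite adj_sym; apply: hw.
      have <- : nth x0 (drop (size s - k) s) (j - (size s - k)) = nth x0 s j.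
        by rewrite nth_drop subnKC // sV; lia.
      by apply: mem_nth; rewrite size_drop sV; lia.
    have <- : nth x0 (take k s) i = nth x0 s i by rewrite nth_take //; lia.
    by apply: mem_nth; rewrite size_takel //; lia.
  by apply: hn => //; rewrite ?sV //; lia.
apply/existsP; exists [ffun i : 'I_#|V| => nth x0 s i]; apply/andP; split.
  apply/injectiveP => i j; rewrite !ffunE => /eqP; rewrite nth_uniq ?sV //.
  by move=> /eqP /val_inj.
apply/forallP => i; apply/forallP => j; apply/implyP => /andP [ne dist]; rewrite !ffunE.
have cd : cyclic_dist j i = cyclic_dist i j by rewrite /cyclic_dist minnC.
case: (ltngtP i j) => [ij|ji|/val_inj ij]; first exact: key.
- by rewrite adj_sym; apply: key; rewrite ?cd.
- by move: ne; rewrite ij eqxx.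
Qed.

(** All that the probabilistic argument needs from the order: lab numbers the
    segments, o is the elimination order, and near will say that the labels of
    two vertices are close. *)
Lemma cyclic_order (near : rel V) t0 ts :
  (forall t, t \in t0 :: ts -> cut_tile (adj G) k q t) ->
  perm_eq (tile_words (t0 :: ts)) (enum V) ->
  (forall w, w \in segs t0.2 ts t0.1 -> {in w &, forall x y, near x y}) ->
  exists (S : {set {set V}}) (o lab : V -> nat),
  [/\ S \subset pairs V,
      forall H : sgraph V, S \subset edges H -> has_ham_cycle_power k (graph_union G H),
      injective o /\ (forall y, #|[set x | (o x < o y) && ([set x; y] \in S)]| <= k - 1),
      forall l, #|[set x | lab x == l]| <= k.+1 * q + k + 6 &
      forall x y, [set x; y] \in S -> lab x = lab y /\ near x y].
Proof.
move=> ht pV hnear; pose ss := segs t0.2 ts t0.1; pose s := flatten ss.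
have ht' t : t \in ts -> cut_tile (adj G) k q t by move=> tts; apply: ht; rewrite inE tts orbT.
have ct0 : cut_tile (adj G) k q t0 by apply: ht; rewrite mem_head.
case/andP: (tile_size1 ct0) => k1 k1'; case/andP: (tile_size2 ct0) => k2 k2'.
have ps : perm_eq s (enum V).
  apply: perm_trans pV; rewrite /s /ss flatten_segs /tile_words /= -catA.
  by rewrite perm_sym perm_catC -catA.
have us : uniq s by rewrite (perm_uniq ps) enum_uniq.
have hall x : x \in s by rewrite (perm_mem ps) mem_enum.
pose lab := seg_index ss.
pose F x y := [&& x != y, ~~ adj G x y, lab x == lab y,
  index x s <= index y s + k & index y s <= index x s + k].
have Fsym x y : F x y = F y x.
  by rewrite /F eq_sym adj_sym (eq_sym (lab x)) [X in _ && (_ && (_ && X))]andbC.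
pose S := [set [set p.1; p.2] | p in [set p : V * V | F p.1 p.2]].
have SE x y : ([set x; y] \in S) = F x y.
  apply/imsetP/idP => [[[x' y']]|Fxy]; last by exists (x, y) => //; rewrite inE.
  rewrite inE /= => Fxy' e0.
  have ne : x' != y' by case/andP: Fxy'.
  have : x \in [set x'; y'] by rewrite -e0 !inE eqxx.
  have : y \in [set x'; y'] by rewrite -e0 !inE eqxx orbT.
  have : x' \in [set x; y] by rewrite e0 !inE eqxx.
  have : y' \in [set x; y] by rewrite e0 !inE eqxx orbT.
  rewrite !inE => /orP [] /eqP h1 /orP [] /eqP h2 /orP [] /eqP h3 /orP [] /eqP h4; subst=> //;
    try by rewrite eqxx in ne.
  by rewrite Fsym.
have [|||o [o_inj ho]] := @elimination V (adj G) k (@adj_sym V G) k_ge3 s F us hall.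
- rewrite /s flatten_segs scan_cat (tile_scan0 ct0) /=.
  by apply: (scan_tiles (q := q) (tile_spare_end ct0 _) ht'); exact: (tile_scan1 ct0).
- by move=> x y /and5P [_ _ _ _].
- by move=> x y /and3P [].
exists S, o, lab; split.
- apply/subsetP => E /imsetP [p]; rewrite inE => Fp ->; rewrite inE cards2.
  by case/andP: Fp => ->.
- move=> H SH.
  have cut x y : x \in drop (size s - k) s -> y \in take k s -> adj G x y.
    have sE : s = (t0.2 ++ tile_words ts) ++ t0.1 by rewrite /s flatten_segs catA.
    rewrite {1 2}sE size_cat drop_cat ltnNge -addnBA // leq_addr /= addKn => xd.
    rewrite sE -catA takel_cat // => yt.
    by have /allP /(_ x xd) /allP := tile_cut ct0; apply.
  apply: (@ham_cycle_power_of_seq _ s) => //.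
  + by rewrite /s flatten_segs size_cat (leq_trans k2) // leq_addr.
  + have nl : near_all k (fun x y => adj G x y || (lab x == lab y)) s.
      apply: (@near_segs V k q (adj G)) => // [w wss x y xw yw|x y ->//].
      by rewrite /lab (seg_index_same us wss xw yw) eqxx orbT.
    move=> x0 i j ij js near_ij; have is_ := ltn_trans ij js.
    set x := nth x0 s i; set y := nth x0 s j; rewrite /adj inE -/(adj G x y).
    case Gxy: (adj G x y) => //=; apply: (subsetP SH).
    have := near_all_nth x0 nl ij js near_ij; rewrite -/x -/y Gxy /= => lxy.
    rewrite SE /F Gxy lxy /x /y !index_uniq // nth_uniq //.
    by apply/and4P; split=> //; lia.
  + by move=> x y xd yt; rewrite /adj inE [_ \in edges G]cut.
- split=> // y; apply: leq_trans (ho y); apply: subset_leq_card.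
  by apply/subsetP => x; rewrite !inE SE.
- move=> l; apply: card_seg_index => // w; exact: (size_segs k2' k1' ht').
- move=> x y; rewrite SE => Fxy; have /eqP lxy : lab x == lab y by case/and5P: Fxy.
  split=> //; have xs : x \in nth [::] ss (lab x) by apply: seg_index_mem.
  have ys : y \in nth [::] ss (lab x) by rewrite lxy; apply: seg_index_mem.
  case: (ltnP (lab x) (size ss)) => hl; last by rewrite nth_default in xs.
  by apply: (hnear (nth [::] ss (lab x))) => //; apply: mem_nth.
Qed.

End CyclicOrder.

(** * Forests of missing edges *)

Section Forest.
Local Open Scope nat_scope.
Variables (V : finType) (T : {set {set V}}) (o lab : V -> nat) (d L : nat).
Hypothesis o_inj : injective o.
Hypothesis T_pairs : forall E, E \in T -> #|E| = 2.
Hypothesis T_lab : forall x y, [set x; y] \in T -> lab x = lab y.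
Hypothesis lab_card : forall l, #|[set x | lab x == l]| <= L.

Definition back y := [set x | (o x < o y) && ([set x; y] \in T)].
Hypothesis back_card : forall y, #|back y| <= d.
Hypothesis d_gt1 : 1 < d.

Let Y0 := [set y | back y != set0].
Let first y := (y \in Y0) && [forall y' in Y0, (lab y' == lab y) ==> (o y <= o y')].

Lemma back_lab x y : x \in back y -> lab x = lab y.
Proof. by rewrite inE => /andP [_ /T_lab]. Qed.

Lemma card_le_back : #|T| <= \sum_y #|back y|.
Proof.
pose D := [set p : V * V | p.1 \in back p.2].
have cD : #|D| = \sum_y #|back y|.
  rewrite -sum1_card (partition_big (fun p : V * V => p.2) xpredT) //=.
  apply: eq_bigr => y _; rewrite -sum1_card.
  rewrite (reindex_onto (fun x => (x, y)) fst) /=.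
    by apply: eq_bigl => x; rewrite !inE !eqxx !andbT.
  by move=> [x y'] /= /andP [_ /eqP ->].
rewrite -cD; apply: (@leq_trans #|[set [set p.1; p.2] | p in D]|); last exact: leq_imset_card.
apply: subset_leq_card; apply/subsetP => E ET; apply/imsetP.
have /eqP/cards2P [x [y [ne eE]]] := T_pairs ET.
case: (ltngtP (o x) (o y)) => [lt|lt|/o_inj exy].
- by exists (x, y) => //=; rewrite !inE /= lt -eE.
- by exists (y, x) => /=; rewrite ?inE /= setUC -?eE ?lt.
- by move: ne; rewrite exy eqxx.
Qed.

Lemma first_exists y : y \in Y0 -> exists2 z, first z & lab z = lab y.
Proof.
move=> yY; case: (arg_minnP (P := fun y' => (y' \in Y0) && (lab y' == lab y)) o (i0 := y)).
  by rewrite yY eqxx.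
move=> z /andP [zY /eqP zl] min; exists z => //; rewrite /first zY /=.
by apply/'forall_implyP => y' y'Y; apply/implyP => /eqP y'l; apply: min; rewrite y'Y y'l zl eqxx.
Qed.

Lemma first_uniq y z : first y -> first z -> lab y = lab z -> y = z.
Proof.
move=> /andP [yY /'forall_implyP hy] /andP [zY /'forall_implyP hz] l.
apply/o_inj/eqP; rewrite eqn_leq.
by have := hy z zY; have := hz y yY; rewrite l eqxx /= => -> ->.
Qed.

Let p1 y := odflt y [pick x in back y].
Let p2 y := odflt y [pick x in back y :\ p1 y].

Lemma p1_back y : y \in Y0 -> p1 y \in back y.
Proof.
rewrite inE /p1 => /set0Pn [x xb]; case: pickP => [z //|/(_ x)].
by rewrite xb.
Qed.

Lemma p2_back y : 1 < #|back y| -> p2 y \in back y :\ p1 y.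
Proof.
move=> c2; have yY : y \in Y0 by rewrite inE -card_gt0 ltnW.
rewrite /p2; case: pickP => [z //|h].
have : #|back y :\ p1 y| = 0 by apply: eq_card0.
by move: c2; rewrite (cardsD1 (p1 y) (back y)) p1_back // => + e0; rewrite e0.
Qed.

(* The earlier ends of the pairs at a first vertex y have no earlier pairs
   themselves, so that a second pair at y yields one more forest edge. *)
Let first2 := [set y | first y && (1 < #|back y|)].
Let Z := p2 @: first2.

Lemma first_back_root y x : first y -> x \in back y -> x \notin Y0.
Proof.
move=> /andP [yY /'forall_implyP hy] xb; apply/negP => xY.
have := hy x xY; rewrite (back_lab xb) eqxx /=.
by move: xb; rewrite inE ltnNge => /andP [/negbTE ->].
Qed.

Lemma ZP z : z \in Z -> exists2 y, y \in first2 & z = p2 y /\ lab z = lab y.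
Proof.
move=> /imsetP [y y2 ->]; exists y => //; split=> //; apply: back_lab.
by move: y2; rewrite inE => /andP [_ /p2_back]; rewrite inE => /andP [].
Qed.

Lemma Z_disjoint : [disjoint Y0 & Z].
Proof.
rewrite disjoint_sym -setI_eq0; apply/eqP/setP => z; rewrite in_setI in_set0.
apply/negP => /andP [/ZP [y + [-> _]]]; rewrite inE => /andP [fy /p2_back].
by rewrite inE => /andP [_ /(first_back_root fy) /negP].
Qed.

Lemma card_Z : #|Z| = #|first2|.
Proof.
apply: card_in_imset => y z; rewrite !inE => /andP [fy y2] /andP [fz z2] e.
apply: first_uniq => //.
have /setD1P [_ h1] := p2_back y2; have /setD1P [_ h2] := p2_back z2.
by rewrite -(back_lab h1) e (back_lab h2).
Qed.

Let par y := if y \in Y0 then p1 y else odflt y [pick z | first z && (lab z == lab y)].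
Let lev y := if y \in Y0 then (if first y then 1 else 3 + o y) else if y \in Z then 2 else 0.

(** Y is the set of vertices with an earlier pair, plus one more vertex for
    each class whose first such vertex has at least two earlier pairs.  A vertex
    brings at most d pairs for its forest edge; the first one in a class brings
    either one pair for one forest edge or at most d pairs for two.  So every
    class that meets T stays at least one pair below d per forest edge, and it
    has at most L vertices. *)
Lemma forest_exists : exists (Y : {set V}) (par : V -> V) (lev : V -> nat),
  (forall y, y \in Y -> [set y; par y] \in T /\ lev (par y) < lev y) /\
  L * #|T| <= (L * d - 1) * #|Y|.
Proof.
exists (Y0 :|: Z), par, lev; split.
  move=> y; rewrite in_setU; case yY: (y \in Y0) => /= yZ.
    have pb := p1_back yY; rewrite /par yY; split.
      by move: pb; rewrite inE setUC => /andP [].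
    rewrite /lev yY; case fy: (first y).
      rewrite (negbTE (first_back_root fy pb)); case: ifP => // /ZP [y'].
      rewrite inE => /andP [fy' y'2] [e l].
      have eyy : y' = y by apply: first_uniq => //; rewrite -l (back_lab pb).
      by have := p2_back y'2; rewrite -e eyy !inE eqxx.
    have : o (p1 y) < o y by move: pb; rewrite inE => /andP [].
    by case: ifP => _; case: ifP => // _; lia.
  have [y' y'2 [e l]] := ZP yZ; move: y'2; rewrite inE => /andP [fy' y'2].
  rewrite /par yY; case: pickP => [z /andP [fz /eqP lz]|/(_ y')]; last by rewrite fy' l eqxx.
  have -> : z = y' by apply: first_uniq => //; rewrite lz.
  split=> /=.
    by have := p2_back y'2; rewrite -e !inE => /andP [_ /andP []].
  have y'Y : y' \in Y0 by case/andP: fy'.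
  by rewrite /lev y'Y fy' yY yZ.
pose F := [set y | first y].
have cY : #|Y0 :|: Z| = #|Y0| + #|first2|.
  rewrite cardsU -card_Z (_ : Y0 :&: Z = set0) ?cards0 ?subn0 //.
  by apply/eqP; rewrite setI_eq0 Z_disjoint.
have F2 : first2 \subset F by apply/subsetP => y; rewrite !inE => /andP [].
have FY : F \subset Y0 by apply/subsetP => y; rewrite inE => /andP [].
have sumB : \sum_y #|back y| + #|F :\: first2| * (d - 1) <= d * #|Y0|.
  rewrite (bigID (mem Y0)) /= [X in _ + X + _]big1 ?addn0; last first.
    by move=> y; rewrite inE negbK => /eqP ->; rewrite cards0.
  have sF : F :\: first2 \subset Y0 by apply: subset_trans (subsetDl _ _) FY.
  rewrite -sum_nat_const (big_setID (F :\: first2)) /= (setIidPr sF).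
  rewrite addnAC -big_split /= mulnC -sum_nat_const [leqRHS](big_setID (F :\: first2)) /=.
  rewrite (setIidPr sF); apply: leq_add; last by apply: leq_sum => y _; apply: back_card.
  apply: leq_sum => y; rewrite !inE => /andP [h1 fy]; move: h1; rewrite fy /= -leqNgt.
  by move=> h; apply: leq_trans (leq_add h (leqnn _)) _; rewrite subnKC // ltnW.
have YF : #|Y0 :|: Z| <= L * #|F|.
  rewrite mulnC -sum_nat_const.
  apply: (@leq_trans (\sum_(f in F) #|[set x | lab x == lab f]|)); last first.
    by apply: leq_sum => f _; apply: lab_card.
  apply: (@leq_trans #|\bigcup_(f in F) [set x | lab x == lab f]|); last first.
    elim/big_rec2: _ => [|f n X _ IH]; first by rewrite cards0.
    by apply: leq_trans (leq_card_setU _ _) _; rewrite leq_add2l.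
  apply: subset_leq_card; apply/subsetP => y; rewrite in_setU => /orP [yY|/ZP [f f2 [_ l]]].
    have [f ff lf] := first_exists yY; apply/bigcupP; exists f; first by rewrite inE.
    by rewrite inE lf.
  by apply/bigcupP; exists f; [apply: (subsetP F2)|rewrite inE l].
have cF : #|F :\: first2| = #|F| - #|first2| by rewrite cardsDS.
have cF2 : #|first2| <= #|F| by apply: subset_leq_card.
have TB := card_le_back.
have key : #|T| + #|F| <= d * #|Y0 :|: Z|.
  rewrite cY mulnDr; move: sumB TB cF cF2; set S := \sum_y _.
  move: (#|F|) (#|first2|) (#|F :\: first2|) (#|Y0|) (#|T|) => f f2 f1 y t h1 h2 eF h3; rewrite eF in h1.
  have : (f - f2) * (d - 1) >= f - f2 by rewrite leq_pmulr // subn_gt0.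
  have : f2 <= d * f2 by rewrite leq_pmull // ltnW.
  by lia.
have key2 : L * (#|T| + #|F|) <= L * (d * #|Y0 :|: Z|) by rewrite leq_mul2l key orbT.
by rewrite mulnBl mul1n; lia.
Qed.

End Forest.

Section CountLabels.
Local Open Scope nat_scope.
Variables (V : finType) (N : nat).
Implicit Types (f : {ffun V -> 'I_N.+1}).
Local Open Scope ring_scope.

(** The difference is taken modulo N.+1, so that the last part is next to the
    first. *)
Definition close (i j : 'I_N.+1) := (i - j) \in [:: 0; Zp1; - Zp1].

(** Along the forest, a labelling is determined by its values at the roots and by
    one of three differences at each vertex of Y. *)
Lemma count_close (Y : {set V}) (par : V -> V) (lev : V -> nat) :
  (forall y, y \in Y -> lev (par y) < lev y)%N ->
  (#|[set f : {ffun V -> 'I_N.+1} | [forall y in Y, close (f y) (f (par y))]]| <=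
    3 ^ #|Y| * N.+1 ^ (#|V| - #|Y|))%N.
Proof.
move=> hlev.
(* Replacing labels by differences along the forest is injective. *)
pose g f : {ffun V -> 'I_N.+1} := [ffun v => if v \in Y then f v - f (par v) else f v].
pose S v := [pred i : 'I_N.+1 | (v \in Y) ==> (i \in [:: 0; Zp1; - Zp1])].
have g_inj : injective g.
  move=> f1 f2 e; apply/ffunP => v; have [n] := ubnP (lev v); elim: n v => // n IH v hv.
  have := congr1 (fun h : {ffun V -> 'I_N.+1} => h v) e; rewrite !ffunE.
  case: ifP => // vY; rewrite (IH (par v)); first by move/(congr1 (fun z => z + f2 (par v))); rewrite !subrK.
  by apply: leq_trans (hlev v vY) _.
rewrite -(card_imset _ g_inj).
apply: (@leq_trans #|family S|).
  apply: subset_leq_card; apply/subsetP => h /imsetP [f]; rewrite inE => /'forall_implyP hf ->.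
  apply/familyP => v; rewrite ffunE /S inE; case: ifP => // vY.
  exact: hf.
rewrite card_family.
have -> : foldr muln 1%N [seq #|S x| | x : V] = (\prod_(v : V) #|S v|)%N.
  by rewrite foldrE big_image.
rewrite (bigID (mem Y)) /=; apply: leq_mul.
  rewrite -prod_nat_const; apply: leq_prod => v vY.
  rewrite (eq_card (B := mem ([:: 0; Zp1; - Zp1] : seq 'I_N.+1))) => [|i]; first exact: card_size.
  by rewrite /S inE vY.
have -> : (#|V| - #|Y| = #|~: Y|)%N by rewrite -(cardsC Y) addKn.
rewrite -prod_nat_const (eq_bigl (mem (~: Y))); last by move=> v; rewrite /= inE.
by apply: leq_prod => v _; rewrite -[leqRHS]card_ord; apply: max_card.
Qed.

End CountLabels.

(** * From a labelling of the vertices to a cyclic order *)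

Section Labels.
Local Open Scope nat_scope.
Variables (V : finType) (G : sgraph V) (k q : nat).
Hypothesis k_ge3 : 3 <= k.
Hypothesis q_gt0 : 0 < q.
Let a := q + k + 2.
Let b := k * q + 3.

Lemma tile_words_cat (ts ts' : seq (seq V * seq V)) :
  tile_words (ts ++ ts') = tile_words ts ++ tile_words ts'.
Proof. by rewrite /tile_words map_cat flatten_cat. Qed.

Lemma cut_tiles_seq (ps : seq ({set V} * {set V})) (X : seq V) :
  (forall p, p \in ps -> is_tile (adj G) a b 1 p) -> size X <= size ps ->
  exists ts, [/\ size ts = size ps, forall t, t \in ts -> cut_tile (adj G) k q t &
    perm_eq (tile_words ts) (flatten [seq enum (p.1 : {set V}) ++ enum (p.2 : {set V}) | p <- ps] ++ X)].
Proof.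
elim: ps X => [|p ps IH] X hp sX.
  by exists [::]; split=> //; case: X sX.
have [||ts [sts hts pts]] := IH (behead X).
- by move=> p' p'ps; apply: hp; rewrite inE p'ps orbT.
- by rewrite size_behead; move: sX => /=; lia.
have := hp p (mem_head _ _); case/and3P => /eqP c1 /eqP c2 /'forall_implyP c12.
have [||||t [ct pt]] := @cut_tile_exists V (adj G) k (@adj_sym V G) k_ge3 q
    (enum p.1) (enum p.2) (take 1 X) q_gt0.
- apply/allP => x; rewrite mem_enum => /c12 /'forall_implyP h; apply/allP => y.
  by rewrite mem_enum => /h.
- by rewrite -cardE c1 mul1n.
- by rewrite -cardE c2 mul1n.
- by rewrite size_take_min geq_minl.
exists (t :: ts); split=> /=; first by rewrite sts.
  by move=> t'; rewrite inE => /orP [/eqP ->|/hts].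
apply/permP => P; have /permP/(_ P) := pt; have /permP/(_ P) := pts.
rewrite (_ : tile_words (t :: ts) = (t.1 ++ t.2) ++ tile_words ts) //.
have : count P X = count P (take 1 X) + count P (behead X).
  by case: (X) => [|x X'] //=; rewrite take0 /= addn0.
by rewrite !count_cat; lia.
Qed.

Lemma count_enum (P : pred V) (A : {set V}) : count P (enum A) = \sum_(v in A) P v.
Proof. by rewrite -sum1_count big_enum_cond -big_mkcondr. Qed.

(** There are at most as many uncovered vertices as tiles, so that each tile word
    takes at most one of them. *)
Lemma cut_tiles_of_tiling (U : {set V}) Q :
  tiling (adj G) a b 1 U Q -> #|U| <= #|Q| * (a + b).+1 ->
  exists ts, [/\ size ts = #|Q|, forall t, t \in ts -> cut_tile (adj G) k q t &
    perm_eq (tile_words ts) (enum U)].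
Proof.
move=> tQ hU; have irr := @adj_irr V G.
have cU := cover_subset tQ.
have cQ := card_cover_tiling irr tQ; rewrite mul1n in cQ.
have [||ts [sts hts pts]] := @cut_tiles_seq (enum Q) (enum (U :\: cover Q)).
- by move=> p; rewrite mem_enum => /tQ.1 [].
- by rewrite -!cardE cardsDS // cQ leq_subLR addnC -mulnS.
exists ts; split=> //; first by rewrite sts -cardE.
apply: perm_trans pts _; apply/permP => P; rewrite count_cat.
rewrite count_flatten sumnE !big_map big_enum /= !count_enum.
rewrite [RHS](big_setID (cover Q)) /= (setIidPr cU); congr (_ + _).
rewrite (sum_cover _ tQ); apply: eq_bigr => p pQ; rewrite count_cat !count_enum.
have [tp _] := tQ.1 p pQ; have dp := tile_disjoint irr tp.
rewrite /supp [RHS](big_setID p.1) /= setUK; congr (_ + _).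
apply: eq_bigl => x; rewrite !inE; case x1: (x \in p.1) => //=.
by rewrite (disjointFr dp x1).
Qed.

(** A segment consists of the right part of a tile and the left part of the next,
    so it meets at most two consecutive label classes. *)
Lemma segs_labels (g : V -> nat) (step R : rel nat) r (ps : seq (nat * (seq V * seq V))) l i0 il :
  (forall i, R i i) -> (forall i i', step i i' -> R i i' && R i' i) ->
  (forall x, x \in r -> g x = i0) ->
  (forall p, p \in ps -> forall x, x \in p.2.1 ++ p.2.2 -> g x = p.1) ->
  path step i0 [seq p.1 | p <- ps] ->
  (forall x, x \in l -> g x = il) ->
  R (last i0 [seq p.1 | p <- ps]) il && R il (last i0 [seq p.1 | p <- ps]) ->
  forall w, w \in segs r [seq p.2 | p <- ps] l -> {in w &, forall x y, R (g x) (g y)}.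
Proof.
move=> Rr Rs + + + hl.
have two (u v : seq V) i i' : (forall x, x \in u -> g x = i) -> (forall x, x \in v -> g x = i') ->
    R i i' && R i' i -> {in u ++ v &, forall x y, R (g x) (g y)}.
  move=> hu hv /andP [R1 R2] x y; rewrite !mem_cat => /orP [/hu|/hv] -> /orP [/hu|/hv] -> //.
elim: ps r i0 => [|[i [tl tr]] ps IH] r i0 hr hps /= hp hlast w.
  by rewrite inE => /eqP ->; apply: two hr hl hlast.
have hi := hps _ (mem_head _ _); rewrite /= in hi.
case/andP: hp => si hp; rewrite inE => /orP [/eqP ->|].
  by apply: (two _ _ i0 i) => //; [move=> x xt; apply: hi; rewrite mem_cat xt|exact: Rs].
apply: (IH tr i) => //; first by move=> x xt; apply: hi; rewrite mem_cat xt orbT.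
by move=> p pps; apply: hps; rewrite inE pps orbT.
Qed.

Definition next_label N : rel nat := fun i i' => (i' <= N) && ((i' == i) || (i' == i.+1)).

Lemma path_runs N (sz : nat -> nat) m j0 : j0 + m <= N ->
  (forall j, j <= N -> 0 < sz j) ->
  let w := flatten [seq nseq (sz j) j | j <- iota j0.+1 m] in
  path (next_label N) j0 w /\ last j0 w = j0 + m.
Proof.
move=> + hsz; elim: m j0 => [|m IH] j0 hm /=; first by rewrite addn0.
have [|hp hlast] := IH j0.+1; first by rewrite addSnnS.
have : 0 < sz j0.+1 by apply: hsz; lia.
case: (sz j0.+1) => // n _ /=.
have st : next_label N j0.+1 j0.+1 by rewrite /next_label eqxx andbT; lia.
have -> : next_label N j0 j0.+1 by rewrite /next_label eqxx orbT andbT; lia.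
have runs u : path (next_label N) j0.+1 (nseq n j0.+1 ++ u) = path (next_label N) j0.+1 u /\
    last j0.+1 (nseq n j0.+1 ++ u) = last j0.+1 u.
  by elim: n => //= n [-> ->]; rewrite st.
by rewrite (runs _).1 (runs _).2 hp hlast addSnnS.
Qed.

Lemma close_refl N (i : 'I_N.+1) : close i i.
Proof. by rewrite /close subrr inE eqxx. Qed.

Lemma close_sym N (i j : 'I_N.+1) : close i j = close j i.
Proof.
have opp (x : 'I_N.+1) : (x \in [:: 0; Zp1; - Zp1]%R) -> ((- x)%R \in [:: 0; Zp1; - Zp1]%R).
  by rewrite !inE => /or3P [] /eqP ->; rewrite ?oppr0 ?opprK eqxx ?orbT.
by apply/idP/idP => /opp; rewrite opprB.
Qed.

Lemma close_next N i : i <= N -> close (inord i.+1 : 'I_N.+1) (inord i).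
Proof.
move=> iN; rewrite /close !inE; apply/orP; right; apply/orP; left.
have iv : (inord i : 'I_N.+1) = i :> nat by rewrite inordK.
rewrite subr_eq addrC; apply/eqP/val_inj; rewrite /= modnDmr iv addn1.
case: (ltngtP i N) iN => // [lt _|-> _].
  by rewrite inordK ?ltnS // modn_small ?ltnS.
rewrite modnn /inord /insubd insubF //= ltnn //.
Qed.

Lemma cyclic_order_of_labelling N (f : {ffun V -> 'I_N.+1}) :
  (forall j, exists ts, [/\ ts != [::], forall t, t \in ts -> cut_tile (adj G) k q t &
     perm_eq (tile_words ts) (enum [set u | f u == j])]) ->
  exists (S : {set {set V}}) (o lab : V -> nat),
  [/\ S \subset pairs V,
      forall H : sgraph V, S \subset edges H -> has_ham_cycle_power k (graph_union G H),
      injective o /\ (forall y, #|[set x | (o x < o y) && ([set x; y] \in S)]| <= k - 1),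
      forall l, #|[set x | lab x == l]| <= k.+1 * q + k + 6 &
      forall x y, [set x; y] \in S -> lab x = lab y /\ close (f x) (f y)].
Proof.
move=> /fin_all_exists [tsf htsf]; pose tsn j := tsf (inord j).
have tsP j : tsn j != [::] by case: (htsf (inord j)).
have [t0 [rest0 E0]] : exists t0 rest0, tsn 0 = t0 :: rest0.
  by case: (tsn 0) (tsP 0) => // t0 r0 _; exists t0, r0.
pose tl := [seq [seq (j, t) | t <- tsn j] | j <- iota 1 N].
(* The tiles with their labels, after t0, where the cycle is opened. *)
pose ps := [seq (0, t) | t <- rest0] ++ flatten tl.
have snd_ps : t0 :: [seq p.2 | p <- ps] = flatten [seq tsn j | j <- iota 0 N.+1].
  rewrite /= E0 /= /ps map_cat -map_comp map_id_in //; congr (_ :: _ ++ _).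
  rewrite map_flatten -map_comp; congr flatten; apply: eq_map => j /=.
  by rewrite -map_comp map_id_in.
have mem_ps t : t \in t0 :: [seq p.2 | p <- ps] -> exists j, t \in tsn j.
  by rewrite snd_ps => /flattenP [w /mapP [j _ ->] tw]; exists j.
have f_lab j t x : j <= N -> t \in tsn j -> x \in t.1 ++ t.2 -> f x = j :> nat.
  move=> jN tj xt; have [_ _ /perm_mem/(_ x)] := htsf (inord j).
  have -> : x \in tile_words (tsf (inord j)).
    by apply/flattenP; exists (t.1 ++ t.2) => //; apply: map_f.
  by rewrite mem_enum inE => /esym/eqP ->; rewrite inordK.
have lab_ps p : p \in ps -> p.1 <= N /\ p.2 \in tsn p.1.
  rewrite mem_cat => /orP [/mapP [t tr ->] /=|/flattenP [w /mapP [j + ->] /mapP [t tj ->]] /=].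
    by rewrite E0 inE tr orbT.
  by rewrite mem_iota => jN; split=> //; lia.
have fst_ps : [seq p.1 | p <- ps] = nseq (size rest0) 0 ++
    flatten [seq nseq (size (tsn j)) j | j <- iota 1 N].
  rewrite /ps map_cat -map_comp; congr (_ ++ _).
    by elim: (rest0) => //= t r <-.
  rewrite map_flatten -map_comp; congr flatten; apply: eq_map => j /=.
  by elim: (tsn j) => //= t r <-.
have [|hp hlast] := @path_runs N (fun j => size (tsn j)) N 0 (leqnn _).
  by move=> j _; rewrite lt0n size_eq0.
apply: (@cyclic_order V G k q k_ge3 (fun x y => close (f x) (f y)) t0 [seq p.2 | p <- ps]).
- by move=> t /mem_ps [j tj]; have [_ h _] := htsf (inord j); apply: h.
- rewrite snd_ps; apply/permP => P.
  have cnt (s : seq nat) : count P (tile_words (flatten [seq tsn j | j <- s])) =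
      \sum_(j <- s) count P (tile_words (tsn j)).
    elim: s => [|j s IH]; first by rewrite big_nil.
    by rewrite big_cons /= tile_words_cat count_cat IH.
  rewrite cnt -[iota 0 N.+1]/(index_iota 0 N.+1) big_mkord.
  rewrite (eq_bigr (fun j : 'I_N.+1 => \sum_(v | f v == j) P v)) => [|j _]; last first.
    have [_ _ /permP/(_ P)] := htsf j; rewrite /tsn inord_val => ->.
    by rewrite count_enum; apply: eq_bigl => v; rewrite inE.
  have -> : count P (enum V) = \sum_v P v.
    by rewrite -sum1_count big_enum_cond big_mkcond; apply: eq_bigr => v _; case: (P v).
  by rewrite [RHS](partition_big f xpredT).
move=> w hw x y xw yw.
pose Rel : rel nat := fun i i' => close (inord i : 'I_N.+1) (inord i').
have h0 z : z \in t0.1 ++ t0.2 -> nat_of_ord (f z) = 0.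
  by apply: (f_lab 0) => //; rewrite E0 mem_head.
suff : Rel (f x) (f y) by rewrite /Rel !inord_val.
apply: (@segs_labels (fun z => f z : nat) (next_label N) Rel t0.2 ps t0.1 0 0 _ _ _ _ _ _ _ w hw x y xw yw).
- by move=> i; apply: close_refl.
- move=> i i' /andP [iN /orP [] /eqP e0]; rewrite /Rel e0 ?close_refl // close_sym andbb.
  by rewrite close_next //; lia.
- by move=> z zr; apply: h0; rewrite mem_cat zr orbT.
- by move=> p /lab_ps [pN tp] z; apply: f_lab pN tp.
- have st0 : next_label N 0 0 by rewrite /next_label eqxx leq0n.
  by rewrite fst_ps; elim: (size rest0) => [|n IH] //=; rewrite st0 IH.
- by move=> z zr; apply: h0; rewrite mem_cat zr.
have -> : last 0 [seq p.1 | p <- ps] = N.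
  rewrite fst_ps last_cat (_ : last 0 (nseq _ 0) = 0) ?hlast //.
  by elim: (size rest0).
rewrite /Rel close_sym andbb.
have := @close_next N N (leqnn N).
by rewrite (_ : inord N.+1 = inord 0 :> 'I_N.+1) //; apply: val_inj; rewrite /inord !val_insubd ltnn.
Qed.

End Labels.

(** * A Chernoff bound for random labellings *)

Section Chernoff.
Local Open Scope ring_scope.
Variable R : realType.

(** From [expR_ge1Dx] at x, by inversion; the constant 2 leaves room for x < 0. *)
Lemma expRN_le_quadratic (x : R) : `|x| <= 1 / 2 -> expR (- x) <= 1 - x + 2 * x ^+ 2.
Proof.
move=> hx; have /andP [x1 x2] : - (1 / 2) <= x <= 1 / 2 by rewrite -ler_norml.
have d0 : 0 < 1 + x by lra.
rewrite expRN; apply: (@le_trans _ _ (1 + x)^-1).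
  by rewrite lef_pV2 ?posrE ?expR_gt0 // expR_ge1Dx.
rewrite -div1r ler_pdivrMr //.
have -> : (1 - x + 2 * x ^+ 2) * (1 + x) = 1 + x ^+ 2 * (1 + 2 * x) by ring.
by rewrite lerDl mulr_ge0 ?sqr_ge0 //; lra.
Qed.

(** Exponential moments at t = beta / 4: a label equals j with probability
    1 / N.+1, so each u contributes a factor at most
    expR ((- t * w u + 2 * t ^+ 2) / N.+1). *)
Lemma chernoff_labels (V : finType) (N : nat) (w : V -> R) (beta theta : R) (j : 'I_N.+1) :
  0 < beta -> beta <= 1 -> (forall u, `|w u| <= 1) -> beta * #|V|%:R <= \sum_u w u ->
  #|[set f : {ffun V -> 'I_N.+1} | \sum_(u | f u == j) w u <= theta]|%:R <=
  N.+1%:R ^+ #|V| * expR (beta / 4 * theta - beta ^+ 2 / 8 * (#|V|%:R / N.+1%:R)).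
Proof.
move=> b0 b1 w1 sw; set t := beta / 4; set N1 : R := N.+1%:R.
have N0 : 0 < N1 by rewrite ltr0n.
pose F u (i : 'I_N.+1) : R := expR (- (t * if i == j then w u else 0)).
have prodF (f : {ffun V -> 'I_N.+1}) :
    \prod_u F u (f u) = expR (- (t * \sum_(u | f u == j) w u)).
  rewrite -expR_sum; congr expR; rewrite mulr_sumr -sumrN big_mkcond [RHS]big_mkcond /=.
  by apply: eq_bigr => u _; case: ifP => _; rewrite ?mulr0 ?oppr0.
have sumF u : \sum_i F u i = N%:R + expR (- (t * w u)).
  rewrite (bigD1 j) //= /F eqxx addrC; congr (_ + _).
  rewrite (eq_bigr (fun _ => 1)); last by move=> i /negbTE ->; rewrite mulr0 oppr0 expR0.
  by rewrite sumr_const cardC1 card_ord.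
apply: (@le_trans _ _ (expR (t * theta) * \prod_u \sum_i F u i)).
  rewrite bigA_distr_bigA /= mulr_sumr -sum1_card natr_sum big_mkcond /=.
  apply: ler_sum => f _; rewrite prodF -expRD inE; case: ifP => h; last exact: expR_ge0.
  rewrite -expR0 ler_expR subr_ge0 ler_wpM2l // /t; lra.
have le_u u : \sum_i F u i <= N1 * expR ((- (t * w u) + 2 * t ^+ 2) / N1).
  apply: (@le_trans _ _ (N1 * (1 + (- (t * w u) + 2 * t ^+ 2) / N1))); last first.
    by rewrite ler_wpM2l ?(ltW N0) // expR_ge1Dx.
  rewrite mulrDr mulr1 mulrCA mulfV ?gt_eqF // mulr1 sumF /N1 -natr1.
  have tw : `|t * w u| <= 1 / 2.
    rewrite normrM (gtr0_norm (_ : 0 < t)); last by rewrite /t; lra.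
    by apply: (@le_trans _ _ (t * 1)); [rewrite ler_wpM2l ?w1 // /t; lra|rewrite /t; lra].
  have := expRN_le_quadratic tw.
  have : (t * w u) ^+ 2 <= t ^+ 2.
    rewrite exprMn -[leRHS]mulr1 ler_wpM2l ?sqr_ge0 // -[w u ^+ 2]ger0_norm ?sqr_ge0 //.
    by rewrite normrX exprn_ile1.
  lra.
apply: (@le_trans _ _ (expR (t * theta) * \prod_u (N1 * expR ((- (t * w u) + 2 * t ^+ 2) / N1)))).
  rewrite ler_wpM2l ?expR_ge0 //; apply: ler_prod => u _; rewrite le_u andbT.
  by apply: sumr_ge0 => i _; apply: expR_ge0.
rewrite big_split /= prodr_const mulrCA ler_wpM2l ?exprn_ge0 ?(ltW N0) //.
rewrite -expR_sum -expRD ler_expR lerD2l -mulr_suml big_split /= sumrN -mulr_sumr sumr_const.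
rewrite (_ : - (beta ^+ 2 / 8 * (#|V|%:R / N1)) = - (beta ^+ 2 / 8 * #|V|%:R) / N1); last by rewrite mulNr mulrA.
apply: ler_wpM2r; first by rewrite invr_ge0 ltW.
rewrite -[_ *+ _]mulr_natr.
have : t * (beta * #|V|%:R) <= t * \sum_u w u by rewrite ler_wpM2l // /t; lra.
rewrite (_ : t * (beta * #|V|%:R) = beta ^+ 2 / 4 * #|V|%:R); last by rewrite /t; field.
rewrite (_ : 2 * t ^+ 2 * #|V|%:R = beta ^+ 2 / 8 * #|V|%:R); last by rewrite /t; field.
lra.
Qed.

End Chernoff.

(** * The threshold, for given constants *)

Section Core.
Local Open Scope ring_scope.
Variables (R : realType) (V : finType) (G : sgraph V) (k q N : nat).
Hypothesis k_ge3 : (3 <= k)%N.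
Hypothesis q_gt0 : (0 < q)%N.
Let L := (k.+1 * q + k + 6)%N.
Let d := (k - 1)%N.

(** The spread of the family: if T lies in the missing set of some labelling, it
    contains the forest of [forest_exists], whose edges must be close for every
    other such labelling; few labellings achieve this by [count_close]. *)
Lemma ham_cycle_power_prob (good : {set {ffun V -> 'I_N.+1}}) (rho p : R) (r : nat) :
  (forall f j, f \in good -> exists ts, [/\ ts != [::],
     forall t, t \in ts -> cut_tile (adj G) k q t &
     perm_eq (tile_words ts) (enum [set u | f u == j])]) ->
  (N.+1 ^ #|V| <= 2 * #|good|)%N ->
  0 < rho -> rho <= 1 -> 3 / N.+1%:R <= rho ^+ (L * d - 1) ->
  (d * #|V| < 2 ^ r)%N -> (1 < r)%N -> 16 * r%:R ^+ 2 * rho ^+ L <= p -> p <= 1 ->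
  1 / 2 <= gnp_prob p (fun H => has_ham_cycle_power k (graph_union G H)).
Proof.
move=> hgood cgood rho0 rho1 hrho hr r1 hp p1.
pose P (f : {ffun V -> 'I_N.+1}) (S : {set {set V}}) := f \in good ->
  exists (o lab : V -> nat),
  [/\ S \subset pairs V,
      forall H : sgraph V, S \subset edges H -> has_ham_cycle_power k (graph_union G H),
      injective o /\ (forall y, (#|[set x | (o x < o y)%N && ([set x; y] \in S)]| <= d)%N),
      forall l, (#|[set x | lab x == l]| <= L)%N &
      forall x y, [set x; y] \in S -> lab x = lab y /\ close (f x) (f y)].
have /fin_all_exists [S hS] : forall f, exists S, P f S.
  move=> f; case fg: (f \in good); last by exists set0; rewrite /P fg.
  have [S [o [lab h]]] := cyclic_order_of_labelling k_ge3 q_gt0 (fun j => hgood f j fg).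
  by exists S => _; exists o, lab.
have N0 : 0 < N.+1%:R :> R by rewrite ltr0n.
have good0 : (0 < #|good|)%N.
  by move: cgood; have := expn_gt0 N.+1 #|V|; case: #|good| => //; lia.
apply: (@gnp_prob_spread R V p (2 * rho ^+ L) r _ good S) => //.
- by rewrite mulr_gt0 ?exprn_gt0.
- by apply: le_trans hp; rewrite mulrA (_ : 8 * _ * 2 = 16 * r%:R ^+ 2) //; ring.
- move=> f fg; have [o [lab [SP _ [o_inj ho] _ _]]] := hS f fg; split=> //.
  apply: leq_ltn_trans hr; rewrite mulnC -sum_nat_const.
  apply: leq_trans (card_le_back o_inj _) _; last by apply: leq_sum => y _; apply: ho.
  by move=> E /(subsetP SP); rewrite inE => /eqP.
- by move=> f H fg SH; have [o [lab [_ h _ _ _]]] := hS f fg; apply: h.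
move=> T; case: (posnP #|T|) => [T0|Tpos].
  rewrite T0 expr0 mul1r ler_nat; apply: subset_leq_card; apply/subsetP => f.
  by rewrite inE => /andP [].
case: (set_0Vmem [set f in good | T \subset S f]) => [->|[f0]].
  by rewrite cards0 mulr_ge0 // exprn_ge0 // mulr_ge0 // exprn_ge0 // ltW.
rewrite inE => /andP [f0g TS0].
have [o [lab [SP _ [o_inj ho] hlab hclose]]] := hS f0 f0g.
have [|||y||Y [par [lev [hY cY]]]] := @forest_exists V T o lab d L o_inj.
- by move=> E /(subsetP TS0) /(subsetP SP); rewrite inE => /eqP.
- by move=> x y /(subsetP TS0) /hclose [].
- exact: hlab.
- apply: leq_trans (ho y); apply: subset_leq_card; apply/subsetP => x; rewrite !inE.
  by move=> /andP [-> /(subsetP TS0) ->].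
- by rewrite /d; lia.
have YV : (#|Y| <= #|V|)%N by apply: max_card.
have cnt : (#|[set f in good | T \subset S f]| * N.+1 ^ #|Y| <= 3 ^ #|Y| * (2 * #|good|))%N.
  apply: (@leq_trans (3 ^ #|Y| * N.+1 ^ (#|V| - #|Y|) * N.+1 ^ #|Y|)).
    rewrite leq_mul2r; apply/orP; right; apply: leq_trans _ (@count_close V N Y par lev _); last by move=> y /hY [].
      apply: subset_leq_card; apply/subsetP => f; rewrite !inE => /andP [fg TSf].
      apply/'forall_implyP => y yY; have [o' [lab' [_ _ _ _ hc]]] := hS f fg.
      have [yT _] := hY y yY.
      by have [_] := hc _ _ (subsetP TSf _ yT).
  by rewrite -mulnA -expnD subnK // leq_mul2l cgood orbT.
set cT := #|_| in cnt *.
have cnt' : cT%:R <= (3 / N.+1%:R) ^+ #|Y| * (2 * #|good|%:R) :> R.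
  rewrite exprMn exprVn mulrAC ler_pdivlMr ?exprn_gt0 //.
  by rewrite -!natrX -!natrM ler_nat.
apply: le_trans cnt' _; rewrite mulrA; apply: ler_wpM2r => //.
apply: (@le_trans _ _ (rho ^+ (L * #|T|) * 2)).
  apply: ler_wpM2r => //; apply: (@le_trans _ _ ((rho ^+ (L * d - 1)) ^+ #|Y|)).
    by rewrite lerXn2r ?nnegrE ?divr_ge0 ?exprn_ge0 // ltW.
  by rewrite -exprM; apply: ler_wiXn2l => //; rewrite ltW.
rewrite exprMn exprM mulrC; apply: ler_wpM2r; first by rewrite !exprn_ge0 // ltW.
by rewrite -[leLHS]expr1 ler_weXn2l // ler1n.
Qed.

(** With delta the required density, the slack theta also makes every class
    larger than theta. *)
Definition balanced (delta theta : R) : {set {ffun V -> 'I_N.+1}} :=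
  [set f : {ffun V -> 'I_N.+1} | [forall v, forall j, theta + delta * #|[set u | f u == j]|%:R <
     #|nbrs (adj G) v [set u | f u == j]|%:R]].

(** For each vertex v and label j, [chernoff_labels] is applied to the weights
    1 - delta on the neighbours of v and - delta elsewhere, whose sum is at least
    beta * #|V|. *)
Lemma most_labellings_balanced (delta beta theta : R) :
  0 < beta -> beta <= 1 -> 0 <= delta -> delta <= 1 ->
  (forall v, (delta + beta) * #|V|%:R <= (degree G v)%:R) ->
  2 * (#|V|%:R * N.+1%:R) * expR (beta / 4 * theta - beta ^+ 2 / 8 * (#|V|%:R / N.+1%:R)) <= 1 ->
  (N.+1 ^ #|V| <= 2 * #|balanced delta theta|)%N.
Proof.
move=> b0 b1 d0 d1 hdeg small; set good := balanced delta theta.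
pose w v u : R := (adj G v u)%:R - delta.
have sumw v (U : {set V}) : \sum_(u in U) w v u = #|nbrs (adj G) v U|%:R - delta * #|U|%:R.
  rewrite sumrB sumr_const mulr_natr -natr_sum; congr (_%:R - _).
  rewrite -sum1_card [RHS]big_mkcond [LHS]big_mkcond; apply: eq_bigr => u _.
  by rewrite inE; case: (u \in U); case: (adj G v u).
pose bad v j := [set f : {ffun V -> 'I_N.+1} | \sum_(u | f u == j) w v u <= theta].
set X := expR _ in small.
have cbad v j : #|bad v j|%:R <= N.+1%:R ^+ #|V| * X.
  apply: chernoff_labels => //.
    by move=> u; rewrite /w ler_norml; case: (adj G v u) => /=; lra.
  have := sumw v setT; rewrite (eq_bigl xpredT) => [->|u]; last by rewrite inE.
  have -> : nbrs (adj G) v setT = [set u | adj G v u] by apply/setP => u; rewrite !inE.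
  by have := hdeg v; rewrite cardsT /degree mulrDl; lra.
have cover : ~: good \subset \bigcup_v \bigcup_j bad v j.
  apply/subsetP => f; rewrite !inE negb_forall => /existsP [v].
  rewrite negb_forall => /existsP [j]; rewrite -leNgt => h.
  apply/bigcupP; exists v => //; apply/bigcupP; exists j => //; rewrite inE.
  have := sumw v [set u | f u == j]; under eq_bigl => u do rewrite inE.
  by move=> ->; lra.
have bound : #|~: good|%:R <= #|V|%:R * (N.+1%:R * (N.+1%:R ^+ #|V| * X)).
  have cup (I : finType) (B : I -> {set {ffun V -> 'I_N.+1}}) (x : R) :
      (forall i, #|B i|%:R <= x) -> #|\bigcup_i B i|%:R <= #|I|%:R * x.
    move=> hB; apply: (@le_trans _ _ (\sum_(i : I) x)); last by rewrite sumr_const mulr_natl.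
    apply: (big_ind2 (fun (A : {set {ffun V -> 'I_N.+1}}) y => #|A|%:R <= y)).
    - by rewrite cards0.
    - move=> A x1 B' x2 h1 h2; apply: (@le_trans _ _ (#|A| + #|B'|)%:R).
        by rewrite ler_nat leq_card_setU.
      by rewrite natrD lerD.
    - by move=> i _; apply: hB.
  apply: (@le_trans _ _ #|\bigcup_v \bigcup_j bad v j|%:R); first by rewrite ler_nat subset_leq_card.
  apply: (cup) => v; have := @cup _ (bad v) (N.+1%:R ^+ #|V| * X) (cbad v).
  by rewrite card_ord.
rewrite -(ler_nat R) natrX natrM.
have tot : #|good|%:R + #|~: good|%:R = N.+1%:R ^+ #|V| :> R.
  by rewrite -natrD cardsC card_ffun card_ord natrX.
have Np : 0 <= N.+1%:R ^+ #|V| :> R by rewrite exprn_ge0.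
have : N.+1%:R ^+ #|V| * (2 * (#|V|%:R * N.+1%:R) * X) <= N.+1%:R ^+ #|V| :> R.
  by rewrite -[leRHS]mulr1 ler_wpM2l.
move: bound; rewrite !mulrA; lra.
Qed.

End Core.

(** * The choice of the constants *)

Section Numerics.
Local Open Scope ring_scope.
Variable R : realType.

Lemma expR_beats_power (m : nat) (g E : R) : 0 < g -> 0 <= E ->
  exists Y : R, forall y, 0 <= y -> Y <= y -> E * y ^+ m <= expR (g * y).
Proof.
move=> g0 E0; exists (E * m.+1`!%:R / g ^+ m.+1) => y y0 Yy.
have f0 : 0 < m.+1`!%:R :> R by rewrite ltr0n fact_gt0.
have gy0 : 0 <= g * y by rewrite mulr_ge0 // ltW.
apply: le_trans (expR_ge1Dxn m gy0).
apply: (@le_trans _ _ ((g * y) ^+ m.+1 / m.+1`!%:R)); last by rewrite lerDr.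
rewrite ler_pdivlMr // (_ : (g * y) ^+ m.+1 = g ^+ m.+1 * y * y ^+ m); last first.
  by rewrite exprMn [y ^+ m.+1]exprS mulrA.
rewrite mulrAC; apply: ler_wpM2r; first by rewrite exprn_ge0.
by rewrite [leRHS]mulrC -ler_pdivrMr ?exprn_gt0.
Qed.

(** Working with powers of y = n ^ (1 / Z) keeps all exponents integral. *)
Lemma root_spec (n Z : nat) : (0 < Z)%N -> (0 < n)%N ->
  exists y : R, [/\ 0 < y, y ^+ Z = n%:R &
    forall e : nat, n%:R `^ (- (e%:R / Z%:R)) = y ^- e].
Proof.
move=> Z0 n0; have n0' : 0 < n%:R :> R by rewrite ltr0n.
have Zr : Z%:R != 0 :> R by rewrite pnatr_eq0 -lt0n.
exists (n%:R `^ Z%:R^-1); split; first exact: powR_gt0.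
  by rewrite -powR_mulrn ?powR_ge0 // -powRrM mulVf // powRr1 // ltW.
by move=> e; rewrite powRN mulrC powRrM powR_mulrn // powR_ge0.
Qed.

(** With y = n ^ (1 / Z), classes of size about y leave about n / y labels, and
    the constant factors are absorbed in one more power of y. *)
Lemma parts_bound (n Z e : nat) (y : R) : (2 < Z)%N -> 6 <= y -> y ^+ Z = n%:R ->
  e = (Z - 2)%N ->
  let M := Num.truncn y in
  [/\ (0 < M)%N, (0 < n %/ M)%N, y - 1 <= n%:R / (n %/ M)%:R & 3 / (n %/ M)%:R <= (y ^- 1) ^+ e].
Proof.
move=> Z2 y6 yn eE M; have y0 : 0 < y by lra.
have y0' := ltW y0.
have /andP [My yM] := truncn_itv y0'; rewrite -/M in My yM.
have M6 : 5 < M%:R :> R by move: yM; rewrite -natr1; lra.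
have M0 : (0 < M)%N by rewrite -(ltr_nat R); lra.
have M0' : 0 < M%:R :> R by lra.
have yZ : y ^+ 3 <= n%:R by rewrite -yn ler_weXn2l //; lra.
have y2 : 36 <= y ^+ 2.
  by rewrite (_ : 36 = 6 ^+ 2) ?lerXn2r ?nnegrE //; lra.
have y2n : 36 * y <= n%:R.
  by apply: le_trans yZ; rewrite exprSr; apply: ler_wpM2r.
set N := (n %/ M)%N.
have nM : n%:R < (N.+1 * M)%:R :> R.
  by rewrite ltr_nat {1}(divn_eq n M) mulSn addnC ltn_add2r ltn_pmod.
have Nn : N%:R * M%:R <= n%:R :> R by rewrite -natrM ler_nat leq_trunc_div.
have hN : n%:R <= 2 * y * N%:R.
  move: nM; rewrite natrM -natr1 mulrDl mul1r => nM.
  have : N%:R * M%:R <= N%:R * y by apply: ler_wpM2l.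
  lra.
have N0' : 0 < N%:R :> R.
  by rewrite -(pmulr_rgt0 _ (_ : 0 < 2 * y)); lra.
have N0 : (0 < N)%N by rewrite -(ltr_nat R).
split=> //.
  rewrite ler_pdivlMr // mulrBl mul1r.
  have : N%:R * y <= N%:R * (M%:R + 1) by apply: ler_wpM2l; rewrite // natr1 ltW.
  lra.
rewrite exprVn expr1 ler_pdivrMr // mulrC ler_pdivlMr ?exprn_gt0 //.
have : y ^+ e * y ^+ 2 = n%:R by rewrite -exprD eE subnK // ltnW.
have ye : 0 <= y ^+ e by rewrite exprn_ge0.
rewrite expr2 mulrA => h.
have : 6 * y * y ^+ e <= y ^+ e * y * y.
  have : y ^+ e * y * 6 <= y ^+ e * y * y by apply: ler_wpM2l; rewrite ?mulr_ge0.
  lra.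
rewrite h => h6; have : 6 * y * y ^+ e <= 2 * y * N%:R by apply: le_trans hN.
by rewrite -!mulrA mulrCA [leRHS]mulrCA ler_pM2l //; lra.
Qed.

(** A crude number of rounds, linear in y, replaces the logarithm of n: already
    2 ^ M.+1 exceeds y. *)
Lemma rounds_bound (n Z k d : nat) (y : R) : (0 < Z)%N -> (d <= k)%N -> 1 <= y -> y ^+ Z = n%:R ->
  let r := (Z * (Num.truncn y).+1 + k)%N in
  (d * n < 2 ^ r)%N /\ r%:R <= (2 * Z + k)%:R * y.
Proof.
move=> Z0 dk y1 yn r; have y0 : 0 <= y by lra.
have /andP [My yM] := truncn_itv y0; set M := Num.truncn y in My yM r *.
split.
  have : (n <= 2 ^ (Z * M.+1))%N.
    rewrite -(ler_nat R) -yn mulnC expnM natrX lerXn2r ?nnegrE //.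
    by apply: (le_trans (ltW yM)); rewrite ler_nat ltnW // ltn_expl.
  have : (d < 2 ^ k)%N by apply: leq_ltn_trans dk (ltn_expl _ _).
  rewrite /r expnD [(d * n)%N]mulnC => h1 h2.
  apply: (@leq_ltn_trans (2 ^ (Z * M.+1) * d)); first by rewrite leq_mul2r h2 orbT.
  by rewrite ltn_mul2l expn_gt0.
rewrite /r !natrD !natrM -natr1.
have : Z%:R * (M%:R + 1) <= Z%:R * (2 * y) by apply: ler_wpM2l => //; lra.
have : k%:R * 1 <= k%:R * y by apply: ler_wpM2l.
lra.
Qed.

End Numerics.

Local Open Scope ring_scope.

Theorem theorem3 (R : realType) (k : nat) (alpha : R)
    (k_ge3 : (3 <= k)%N) (alpha_gt0 : 0 < alpha) :
  exists (C : R) (n0 : nat), 0 < C /\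
    forall (n : nat), (n0 <= n)%N ->
    forall (V : finType) (G : sgraph V), #|V| = n ->
      (1 / (k%:R + 1) + alpha) * n%:R <= (min_degree G)%:R ->
    forall p : R, 0 <= p -> p <= 1 ->
      C * n%:R `^ (- (1 / (k%:R - 1))) <= p ->
      1 / 2 <= gnp_prob p (fun H => has_ham_cycle_power k (graph_union G H)).
Proof.
(* K is both the number of blocks A B^k in a tile word and the inverse of the
   degree surplus that the tiling theorem consumes. *)
pose K := (Num.truncn (4 / alpha)).+2.
have K0 : (1 < K)%N by [].
have hK : 4 / alpha <= K%:R.
  have a40 : 0 <= 4 / alpha by rewrite divr_ge0 // ltW.
  have /andP [_ /ltW h] := truncn_itv a40.
  by apply: le_trans h _; rewrite ler_nat.
clearbody K.
pose a := (K + k + 2)%N; pose b := (k * K + 3)%N; pose c := (a + b)%N.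
pose L := (k.+1 * K + k + 6)%N; pose d := (k - 1)%N.
(* With rho = y ^- (L * d + 2), this Z makes rho ^+ (L * d - 1) = y ^- (Z - 2),
   while rho ^+ L is smaller than n ^ (- 1 / d) by the factor y ^- L. *)
pose Z := (d * (L * (L * d + 1)))%N.
pose beta : R := alpha / 2; pose g : R := beta ^+ 2 / 8.
pose theta : R := (tiling_bound a b K)%:R.
pose delta : R := (a * K + c)%:R / (c * K)%:R.
have beta0 : 0 < beta by rewrite /beta; lra.
have g0 : 0 < g by rewrite /g divr_gt0 // exprn_gt0.
have [Y hY] := @expR_beats_power R (2 * Z) g (2 * expR (beta / 4 * theta + g)) g0
  (mulr_ge0 (ler0n _ _) (expR_ge0 _)).
pose Y6 : R := Num.max Y 6.
exists (16 * (2 * Z + k)%:R ^+ 2), ((Num.truncn Y6).+1 ^ Z)%N.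
have d2 : (1 < d)%N by rewrite /d; lia.
have L6 : (6 <= L)%N by rewrite /L; lia.
have Z3 : (2 < Z)%N by rewrite /Z; nia.
have k0 : (0 < k)%N by lia.
split; first by rewrite mulr_gt0 // exprn_gt0 // ltr0n addn_gt0 k0 orbT.
move=> n hn V G cV hdeg p p0 p1 hp.
have n0 : (0 < n)%N by apply: leq_trans hn; rewrite expn_gt0.
have [y [y0 yn yexp]] := @root_spec R n Z (ltnW (ltnW Z3)) n0.
have yY : Y6 <= y.
  set m := (Num.truncn (Y6)).+1 in hn.
  have mY : Y6 <= m%:R.
    have Y60 : 0 <= Y6 by rewrite /Y6 le_max ler0n orbT.
    by have /andP [_ /ltW] := truncn_itv Y60.
  apply: le_trans mY _; rewrite -(@ler_pXn2r _ Z) ?nnegrE ?(ltW y0) //; last by lia.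
  by rewrite yn -natrX ler_nat.
move: yY; rewrite /Y6 ge_max => /andP [yY y6].
have [M0 N0 hM hrho] := parts_bound Z3 y6 yn (erefl (Z - 2)%N).
have y1 : 1 <= y by lra.
have [hr1 hr2] := @rounds_bound R n Z k d y (ltnW (ltnW Z3)) (leq_subr 1 k) y1 yn.
move: M0 N0 hM hrho hr1 hr2; set M := Num.truncn y => M0 N0 hM hrho hr1 hr2.
set r := (Z * M.+1 + k)%N in hr1 hr2.
pose N := (n %/ M).-1; have NE : N.+1 = (n %/ M)%N by rewrite /N prednK.
have nR : 0 < n%:R :> R by rewrite ltr0n.
have hdeg' v : (1 / (k%:R + 1) + alpha) * #|V|%:R <= (degree G v)%:R.
  rewrite cV; apply: le_trans hdeg _; rewrite ler_nat.
  apply: (leq_min_degree G _).1 => //.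
  by apply: (big_ind (fun m => m <= #|V|)%N) => // [m1 m2 h1 h2|x _]; rewrite ?geq_min ?h1 ?max_card.
have k1 : 0 < 1 / (k%:R + 1) :> R by rewrite divr_gt0 // addr_gt0 // ltr0n.
have alpha_lt1 : 1 / (k%:R + 1) + alpha <= 1.
  have [v _] : exists v : V, v \in V by apply/card_gt0P; rewrite cV.
  rewrite -(ler_pM2r nR) [leRHS]mul1r -cV; apply: le_trans (hdeg' v) _.
  by rewrite ler_nat max_card.
have c0 : (0 < c)%N by rewrite /c /a addn2.
have cK0 : 0 < (c * K)%:R :> R by rewrite ltr0n muln_gt0 c0 ltnW.
have kR : 0 < k%:R + 1 :> R by rewrite addr_gt0 // ltr0n.
have KR : 0 < K%:R :> R by rewrite ltr0n ltnW.
have cR : 0 < c%:R :> R by rewrite ltr0n.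
(* a / c exceeds 1 / (k + 1) by at most 1 / K, and 2 / K is at most beta. *)
have delta_le : delta <= 1 / (k%:R + 1) + beta.
  rewrite /delta ler_pdivrMr // mulrDl natrM natrD natrM.
  have h1 : 2 * c%:R <= beta * (c%:R * K%:R).
    have : 2 <= beta * K%:R.
      by move: hK; rewrite ler_pdivrMr // /beta; lra.
    have : (2 <= beta * K%:R) -> 2 * c%:R <= beta * K%:R * c%:R.
      by move=> h; apply: ler_wpM2r => //; rewrite ltW.
    by move=> h /h; rewrite -mulrA [K%:R * _]mulrC.
  have h2 : a%:R * K%:R - c%:R <= 1 / (k%:R + 1) * (c%:R * K%:R) :> R.
    rewrite div1r [leRHS]mulrC ler_pdivlMr // mulrBl lerBlDr natr1 -!(natrD, natrM) ler_nat.
    by rewrite /c /a /b; clear; lia.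
  lra.
have delta0 : 0 <= delta by rewrite divr_ge0.
pose e := (L * (L * d + 1))%N.
have d0 : d%:R != 0 :> R by rewrite pnatr_eq0 -lt0n ltnW.
have e0 : (0 < e)%N by rewrite /e muln_gt0 addn1 /= (leq_trans _ L6).
have expE : 1 / (k%:R - 1) = e%:R / Z%:R :> R.
  have -> : k%:R - 1 = d%:R :> R by rewrite /d natrB // ltnW // ltnW.
  have eR : e%:R != 0 :> R by rewrite pnatr_eq0 -lt0n.
  by rewrite /Z -/e natrM; field; rewrite d0 eR.
have dn : (d * #|V| < 2 ^ r)%N by rewrite cV.
have Lj : (0 < L * d + 2)%N by rewrite addn2.
have rho0 : 0 < y ^- (L * d + 2) by rewrite invr_gt0 exprn_gt0.
have rho1 : y ^- (L * d + 2) <= 1 by rewrite invf_le1 ?exprn_gt0 // exprn_ege1.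
apply: (ham_cycle_power_prob k_ge3 (ltnW K0) (good := balanced G N delta theta) _ _ rho0 rho1 _ dn _ _ p1).
- move=> f j; rewrite inE => /forallP hf.
  set U := [set u | f u == j].
  have hU v : theta + delta * #|U|%:R < #|nbrs (adj G) v U|%:R by have /forallP/(_ j) := hf v.
  have theta0 : 0 <= theta by apply: ler0n.
  have [v0 _] : exists v : V, v \in V by apply/card_gt0P; rewrite cV.
  have U_big : theta < #|U|%:R.
    apply: (@le_lt_trans _ _ (theta + delta * #|U|%:R)); first by rewrite lerDl mulr_ge0.
    by apply: lt_le_trans (hU v0) _; rewrite ler_nat card_nbrs.
  have a0 : (0 < a)%N by rewrite /a addn2.
  have b0 : (0 < b)%N by rewrite /b addn3.
  have ab : (a < b)%N by rewrite /a /b; move: k_ge3 K0; clear; nia.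
  have [||Q [tQ cQ]] := @almost_tiling V (adj G) (@adj_irr V G) (@adj_sym V G) a b a0 b0 K U (ltnW K0) ab.
  + by rewrite -(ler_nat R) ltW.
  + move=> v _; rewrite -/c -(ler_nat R) natrM [leRHS]natrM -ler_pdivrMr // mulrAC -/delta.
    by apply: ltW; apply: le_lt_trans (hU v); rewrite lerDr.
  have [ts [sts hts pts]] := cut_tiles_of_tiling k_ge3 (ltnW K0) tQ cQ.
  exists ts; split=> //; rewrite -size_eq0 sts; apply/eqP => Q0.
  move: cQ U_big; rewrite Q0 mul0n leqn0 => /eqP ->; lra.
- apply: (most_labellings_balanced (beta := beta)) => //.
  + by rewrite /beta; lra.
  + by apply: le_trans delta_le _; rewrite /beta; lra.
  + move=> v; apply: le_trans (hdeg' v); apply: ler_wpM2r => //.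
    by move: delta_le; rewrite /beta; lra.
  rewrite cV NE; have hexp := hY y (ltW y0) yY.
  have h1 : expR (beta / 4 * theta - beta ^+ 2 / 8 * (n%:R / (n %/ M)%:R)) <=
      expR (beta / 4 * theta + g) * expR (- (g * y)).
    rewrite -expRD ler_expR -/g.
    have : g * (y - 1) <= g * (n%:R / (n %/ M)%:R) by apply: ler_wpM2l => //; rewrite ltW.
    by rewrite mulrBr mulr1; lra.
  have h2 : n%:R * (n %/ M)%:R <= y ^+ (2 * Z).
    by rewrite mul2n -addnn exprD yn ler_wpM2l // ler_nat leq_div.
  set X := expR (_ - _) in h1 *; set E := expR (_ + g) in hexp h1 *.
  have E0 : 0 <= E by apply: expR_ge0.
  have X0 : 0 <= X by apply: expR_ge0.
  rewrite expRN in h1.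
  apply: (@le_trans _ _ (2 * y ^+ (2 * Z) * (E / expR (g * y)))).
    by apply: ler_pM => //; [rewrite !mulr_ge0|apply: ler_wpM2l].
  rewrite mulrA ler_pdivrMr ?expR_gt0 // mul1r; apply: le_trans hexp.
  by rewrite mulrAC.
- rewrite NE; apply: le_trans hrho _; rewrite expr1 -exprVn -exprM.
  rewrite (_ : ((L * d + 2) * (L * d - 1) = Z - 2)%N) //.
  have L0 : (0 < L)%N by apply: leq_trans L6.
  have : (0 < L * d)%N by rewrite muln_gt0 L0 ltnW.
  by rewrite /Z; clear; move: (L) (d); nia.
- by rewrite /r; move: k_ge3; clear; lia.
apply: le_trans hp; rewrite expE yexp -(mulrA 16 (r%:R ^+ 2)) -(mulrA 16 ((2 * Z + k)%:R ^+ 2)); apply: ler_wpM2l => //.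
have -> : (y ^- (L * d + 2)) ^+ L = y ^- L * y ^- e.
  by rewrite -!exprVn -exprM -exprD; congr (_ ^+ _); rewrite /e; move: (L) (d); clear; nia.
rewrite (mulrA (r%:R ^+ 2)); apply: ler_wpM2r; first by rewrite invr_ge0 exprn_ge0 // ltW.
rewrite ler_pdivrMr ?exprn_gt0 //.
apply: (@le_trans _ _ (((2 * Z + k)%:R * y) ^+ 2)).
  by rewrite lerXn2r ?nnegrE // mulr_ge0 // ltW.
rewrite exprMn; apply: ler_wpM2l; first by rewrite sqr_ge0.
by rewrite ler_weXn2l // (leq_trans _ L6).
Qed.
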